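(* Let $G$ be a countably infinite amenable cancellative semigroup and let $\mathbf{G},\mathbf{F}_1,\dots,\mathbf{F}_k$ be Følner sequences in $G$ such that $\mathbf{G}$ is tempered. If $S_1,\dots,S_k\subseteq G$ satisfy $\overline{d}_{\mathbf{F}_i}(S_i)>0$ for each $i=1,\dots,k$, then there is $S\subseteq G$ such that $d_{\mathbf{G}}(S)\ge\prod_{i=1}^k\overline{d}_{\mathbf{F}_i}(S_i)$ and $\Delta_1(S)\subseteq D:=\bigcap_{i=1}^k\Delta_2(\mathbf{F}_i,S_i)$. Furthermore, there are $m_1,\dots,m_\ell\in G$, where $$\ell\le\prod_{i=1}^k1/\overline{d}_{\mathbf{F}_i}(S_i),$$ such that $\bigcup_{i=1}^\ell Dm_i^{-1}=G$. If in addition $G$ is a group, then $\bigcup_{i=1}^\ell m_iD=G$ as well.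
   Context: A semigroup $G$ is cancellative if for all $a,b,c\in G$, $ab=ac$ implies $b=c$ and $ba=ca$ implies $b=c$. ''Amenable'' means (discrete) left amenable, i.e. there is a left invariant mean on $\ell_\infty(G)$: a positive linear functional $\lambda:\ell_\infty(G)\to\mathbb{R}$ with $\lambda(1_G)=1$ and $\lambda({}_x\phi)=\lambda(\phi)$ for all $\phi\in\ell_\infty(G)$, $x\in G$, where ${}_x\phi(t)=\phi(xt)$; for countably infinite cancellative semigroups this is equivalent to the existence of a left Følner sequence. ''Følner sequence'' means left Følner sequence: a sequence $(F_N)_{N=1}^\infty$ of finite non-empty subsets of $G$ with $\lim_{N\to\infty}|F_N\cap gF_N|/|F_N|=1$ for all $g\in G$. For $A\subseteq G$, $g\in G$: $g^{-1}A=\{h\in G:gh\in A\}$, $Ag^{-1}=\{h\in G:hg\in A\}$; for $A,B\subseteq G$: $A^{-1}B=\bigcup_{a\in A}a^{-1}B$. A sequence $(F_n)_{n=1}^\infty$ of finite subsets of $G$ is (left) tempered if for some $C>0$, $\left|\bigcup_{k<n}F_k^{-1}(F_ng)\right|\le C|F_n|$ for all $n>1$ and all $g\in G$. For a Følner sequence $\mathbf{F}=(F_N)$ and $S\subseteq G$: $\overline{d}_{\mathbf{F}}(S)=\limsup_{N\to\infty}|S\cap F_N|/|F_N|$, and $d_{\mathbf{F}}(S)=\lim_{N\to\infty}|S\cap F_N|/|F_N|$ when the limit exists (an assertion about $d_{\mathbf{F}}(S)$ includes its existence). $\Delta_1(S)=\{g\in G:S\cap g^{-1}S\ne\emptyset\}$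 and $\Delta_2(\mathbf{F},S)=\{g\in G:\overline{d}_{\mathbf{F}}(S\cap g^{-1}S)>0\}$. *)

(* Defs.v *)
From HB Require Import structures.
From mathcomp Require Import all_boot all_order all_algebra.
From mathcomp Require Import finmap.
From mathcomp Require Import boolp classical_sets functions cardinality reals.
From mathcomp Require Import topology normedtype sequences.

Set Implicit Arguments.
Unset Strict Implicit.
Unset Printing Implicit Defensive.

Import Order.TTheory GRing.Theory Num.Theory.
Import numFieldNormedType.Exports.

Local Open Scope classical_set_scope.
Local Open Scope ring_scope.

Definition cancellative (G : semigroupType) : Prop :=
  forall a b c : G,
    ((a * b)%g = (a * c)%g -> b = c) /\ ((b * a)%g = (c * a)%g -> b = c).

(* [semigroupType] carries no unit or inverse, so being a group is a property
   of its multiplication. *)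
Definition is_group (G : semigroupType) : Prop :=
  exists (e : G) (inv : G -> G), forall x : G,
    [/\ (e * x)%g = x, (x * e)%g = x,
        (inv x * x)%g = e & (x * inv x)%g = e].

(* A functional on l_oo(G) is represented by a total function on [G -> R]
   which is constrained only on bounded functions. *)
Definition left_invariant_mean (R : realType) (G : semigroupType)
    (lam : (G -> R) -> R) : Prop :=
  [/\ forall (a : R) (phi psi : G -> R), bounded_fun phi -> bounded_fun psi ->
        lam (fun t => a * phi t + psi t) = a * lam phi + lam psi,
      forall phi : G -> R, bounded_fun phi ->
        (forall t, 0 <= phi t) -> 0 <= lam phi,
      lam (fun=> 1) = 1
    & forall (x : G) (phi : G -> R), bounded_fun phi ->
        lam (fun t => phi (x * t)%g) = lam phi].

Definition left_amenable (R : realType) (G : semigroupType) : Prop :=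
  exists lam : (G -> R) -> R, left_invariant_mean lam.

(* Cardinality of a finite set; the value is 0 on infinite sets. *)
Definition card (T : choiceType) (A : set T) : nat := #|` fset_set A|.

Section Translates.
Variable G : semigroupType.
Implicit Types (g : G) (A B : set G).

Definition ltrans g A : set G := [set (g * a)%g | a in A].
Definition rtrans A g : set G := [set (a * g)%g | a in A].
(* g^-1 A, A g^-1 and A^-1 B are preimages under translations: G need not
   have inverses. *)
Definition linv g A : set G := [set h | A (g * h)%g].
Definition rinv A g : set G := [set h | A (h * g)%g].
Definition linv_set A B : set G := \bigcup_(a in A) linv a B.

End Translates.

(* Sequences (F_N)_{N >= 1} are indexed from 0: [F N] stands for F_{N+1}. *)
Definition folner (R : realType) (G : semigroupType) (F : nat -> set G) : Prop :=
  (forall N, finite_set (F N) /\ F N !=set0) /\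
  forall g : G,
    (fun N => (card (F N `&` ltrans g (F N)))%:R / (card (F N))%:R : R)
      @ \oo --> (1 : R).

(* The finiteness clause makes the bound meaningful despite the junk value of
   [card]; it is automatic when G is cancellative. *)
Definition tempered (R : realType) (G : semigroupType) (F : nat -> set G)
    : Prop :=
  exists C : R, 0 < C /\
    forall (n : nat) (g : G), (0 < n)%N ->
      let U := \bigcup_(j in [set j | (j < n)%N])
                 linv_set (F j) (rtrans (F n) g) in
      finite_set U /\ (card U)%:R <= C * (card (F n))%:R.

Definition rel_freq (R : realType) (G : semigroupType) (F : nat -> set G)
    (S : set G) : R^nat :=
  fun N => (card (S `&` F N))%:R / (card (F N))%:R.

Definition upper_density (R : realType) (G : semigroupType)
    (F : nat -> set G) (S : set G) : R :=
  limn_sup (rel_freq R F S).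

Definition has_density (R : realType) (G : semigroupType)
    (F : nat -> set G) (S : set G) (d : R) : Prop :=
  rel_freq R F S @ \oo --> d.

Definition Delta1 (G : semigroupType) (S : set G) : set G :=
  [set g | S `&` linv g S !=set0].

Definition Delta2 (R : realType) (G : semigroupType) (F : nat -> set G)
    (S : set G) : set G :=
  [set g | 0 < upper_density R F (S `&` linv g S)].

(* Main.v *)
Require Import Defs.
From HB Require Import structures.
From mathcomp Require Import all_boot all_order all_algebra.
From mathcomp Require Import finmap.
From mathcomp Require Import boolp classical_sets functions cardinality reals.
From mathcomp Require Import topology normedtype sequences.
From mathcomp Require Import ring lra.

(** The sets [A i] are replaced by an event in a system with an invariant,
    finitely additive mean. A free ultrafilter along a subsequence of [F i]
    realizing the upper density of [A i] gives a left invariant mean on [G] for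
    which [A i] has measure at least that density, and sets of upper density 0
    have measure 0 ([folner_mean]). Iterating these means, [G] acts diagonally
    on a product with an invariant mean and an event [E], the product of the
    [A i], such that [mu E >= \prod_i upper_density (F i) (A i)]; moreover, if
    [E] meets its preimage under [h] in positive measure, then [h] lies in [D]
    ([diagonal_system]). It suffices to study the returns of [E].

    The set [S] consists of the visits to [E] of an orbit whose averages along
    [GG] converge to a limit at least [mu E] and which avoids the null events
    that would put a forbidden [h] into [Delta1 S] ([return_times]). With a
    countably additive measure such an orbit is supplied by the pointwise
    ergodic theorem for tempered Folner sequences. Here its finitary form is
    enough ([uniform_approximation]): from some [N] on, independent of [M], the
    averages of length between [N] and [M] stay close to one fixed function
    outside an event of small mean. A point that is good up to [M] exists for
    each [M], and an ultrafilter limit of the sets of visits inherits all the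
    bounds, each of which concerns finitely many elements of [G].

    The finitary theorem combines two facts. The first is a maximal inequality
    ([maximal_inequality]), which rests on a fractional covering lemma for
    tempered families ([covering_weights]): going from large scales to small
    ones, a center receives the mass not blocked by larger cells meeting its
    own. The second is the convexity argument of the mean ergodic theorem:
    among the functions with the same limiting averages as the indicator of
    [E], those of almost minimal norm are close to each other and almost
    invariant.

    That the limit is at least [mu E], and not only nearly so, follows from a
    dichotomy ([good_levels]): either the limit is constant, or it exceeds its
    mean by a definite amount on an event of definite measure, and the
    precision can be adapted to that amount.

    Finally a greedy choice of pairwise null-disjoint preimages of [E] stops
    after at most [1 / mu E] steps, and it can only stop when the translates
    of the return set cover [G] ([syndetic_returns]). In a group [D] is stable
    under inversion, which turns right translates into left ones. *)

Set Implicit Arguments.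
Unset Strict Implicit.
Unset Printing Implicit Defensive.

Import Order.TTheory GRing.Theory Num.Theory.
Import numFieldNormedType.Exports.

Local Open Scope classical_set_scope.
Local Open Scope ring_scope.

Local Notation "x ** y" := (x * y)%g (at level 40, left associativity).

(** * A maximal inequality for tempered families of finite sets *)

Definition frtrans (G : semigroupType) (B : {fset G}) (a : G) : {fset G} :=
  [fset u ** a | u in B]%fset.

Lemma frtransP (G : semigroupType) (B : {fset G}) (a g : G) :
  reflect (exists2 u, u \in B & g = u ** a) (g \in frtrans B a).
Proof.
by apply: (iffP (imfsetP _ _ _ _)) => -[u /= uB ->]; exists u.
Qed.

(** Temperedness in a form free of unions: a bound on every finite part of
    the union is a bound on the union. *)
Definition temperedness (R : realType) (G : semigroupType)
    (P : nat -> {fset G}) (C : R) : Prop :=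
  forall (n : nat) (g : G) (A : {fset G}),
    (forall a, a \in A -> exists2 i, (i < n)%N &
       exists u v, [/\ u \in P i, v \in P n & u ** a = v ** g]) ->
    #|` A|%:R <= C * #|` P n|%:R.

(** Left cancellation makes [b] the only solution of [u ** b = g] for a given
    [u], so the translates [B ** b] through [g] are indexed by elements of [B]. *)
Lemma card_fiber (G : semigroupType) (canc : cancellative G)
    (B T : {fset G}) (g : G) :
  (forall b, b \in T -> g \in frtrans B b) -> (#|` T| <= #|` B|)%N.
Proof.
move=> gT; have /choice[f fP] : forall b, exists u, b \in T -> u \in B /\ g = u ** b.
  move=> b; have [bT|] := boolP (b \in T); last by exists b.
  by have /frtransP[u uB ->] := gT _ bT; exists u.
have <- : #|` [fset f b | b in T]%fset| = #|` T|.
  apply: card_in_imfset => b c /fP[_ gb] /fP[_ gc] bc.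
  by apply: (canc (f b) b c).1; rewrite -gb {1}gc bc.
apply/fsubset_leq_card/fsubsetP => _ /imfsetP[b /= bT ->].
by have [] := fP _ bT.
Qed.

Section Covering.
Variables (R : realType) (G : semigroupType) (P : nat -> {fset G}).
Hypothesis canc : cancellative G.
Hypothesis Pne : forall n, P n != fset0.
Variables (W : {fset G}) (s : G -> nat) (M : nat).
Hypothesis sM : forall a, (s a < M)%N.

Let cell a := frtrans (P (s a)) a.
Let blocked a b := (s a < s b)%N && (cell a `&` cell b != fset0)%fset.
Let N n : R := #|` P n|%:R.

Let N_gt0 n : 0 < N n.
Proof. by rewrite ltr0n cardfs_gt0. Qed.

(** Each center [a] of scale [s a] starts with mass 1 and loses the weight of
    every center of larger scale whose cell meets its own; what remains is
    spread over the cell. The recursion runs downwards from the largest scale,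
    and after [k] rounds the equation holds for the [k] largest scales. *)
Lemma residual_weights : exists w : G -> R, forall a,
  w a = Num.max 0 (1 - \sum_(b <- W | blocked a b) w b) / N (s a).
Proof.
pose rhs (w : G -> R) a :=
  Num.max 0 (1 - \sum_(b <- W | blocked a b) w b) / N (s a).
suff [w wP] : exists w : G -> R,
    forall a, (M <= s a + M)%N -> w a = rhs w a.
  by exists w => a; apply: wP; rewrite leq_addl.
elim: {2}M => [|k [w wP]].
  by exists (fun=> 0) => a; rewrite addn0 leqNgt sM.
exists (rhs w) => a le_a; rewrite /rhs; congr (Num.max _ (_ - _) / _).
apply: eq_bigr => b /andP[lt_ab _]; apply: wP.
by rewrite (leq_trans le_a)// addnS -addSn leq_add2r.
Qed.

(** A fractional covering lemma. The overlap is at most 2 at [g]: take a center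
    [a] of smallest scale among those of positive weight whose cell contains
    [g]. Centers of the same scale contribute at most 1 by [card_fiber], and
    centers of larger scale block [a], so that their weights sum to less than
    1, as [a] still has mass. Conversely the mass of [W] is either kept or
    blocked, and by temperedness a center [b] blocks at most
    [C * #|P (s b)|] others, so the blocked mass is at most [C] times the
    total mass of the cells. *)
Lemma covering_weights (C : R) : temperedness P C ->
  exists w : G -> R, [/\ forall a, 0 <= w a,
    forall g, \sum_(a <- W | g \in cell a) w a <= 2 &
    #|` W|%:R <= (1 + C) * \sum_(a <- W) w a * N (s a)].
Proof.
move=> temp; have [w wE] := residual_weights; exists w.
have w_ge0 a : 0 <= w a.
  by rewrite wE divr_ge0 ?ler0n// le_max lexx.
have w_le a : w a * N (s a) <= 1.
  rewrite wE divfK ?gt_eqF// ge_max ler01 gerBl.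
  exact: sumr_ge0.
split=> // [g|].
- have [/hasP[a0 a0W a0g]|/hasPn none] :=
    boolP (has (fun a => (g \in cell a) && (0 < w a)) W); last first.
    rewrite big_seq_cond big1 ?ler0n// => a /andP[aW ag].
    by have := none _ aW; rewrite ag/= -leNgt => wa; apply/eqP; rewrite eq_le wa w_ge0.
  (* the center of smallest scale, the one blocked by all larger ones *)
  have [a [aW ag wa amin]] : exists a, [/\ a \in W, g \in cell a, 0 < w a &
      forall b, b \in W -> g \in cell b -> 0 < w b -> (s a <= s b)%N].
    move: a0g => /andP[a0g wa0].
    have ex : exists n, `[< exists a, [/\ a \in W, g \in cell a, 0 < w a & s a = n] >].
      by exists (s a0); apply/asboolP; exists a0.
    case: (ex_minnP ex) => n /asboolP[a [aW ag wa <-]] nmin.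
    exists a; split=> // b bW bg wb; apply: nmin; apply/asboolP.
    by exists b.
  rewrite (bigID (fun b => s b == s a))/= -[2]/(1 + 1 : R) lerD//.
  - apply: (@le_trans _ _ (\sum_(b <- W | (g \in cell b) && (s b == s a)) (N (s a))^-1)).
      apply: ler_sum => b /andP[_ /eqP sb].
      by rewrite -[leRHS]div1r ler_pdivlMr// -sb w_le.
    rewrite big_const_seq iter_addr_0 -[_ *+ _]mulr_natl ler_pdivrMr// mul1r ler_nat.
    rewrite -size_filter; set f := [seq _ <- _ | _].
    have -> : size f = #|` [fset b in W | (g \in cell b) && (s b == s a)]%fset|.
      by rewrite card_imfset.
    apply: (card_fiber canc (g := g)) => b; rewrite !inE => /andP[_ /andP[bg /eqP <-]].
    exact: bg.
  - have : 0 < 1 - \sum_(b <- W | blocked a b) w b.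
      by move: wa; rewrite wE pmulr_lgt0 ?invr_gt0// lt_max ltxx.
    rewrite subr_gt0 => /ltW; apply: le_trans.
    rewrite big_seq_cond [leRHS]big_seq_cond.
    rewrite [leLHS]big_mkcond [leRHS]big_mkcond/=; apply: ler_sum => b _.
    have [bW|] := boolP (b \in W) => //=.
    have [bg|/=] := boolP (g \in cell b); last by case: ifP.
    case: eqVneq => [_|ne]/=; first by case: ifP.
    case: ifPn => // nbl; rewrite leNgt; apply/negP => wb.
    move/negP: nbl; apply; rewrite /blocked ltn_neqAle eq_sym ne amin//=.
    by apply/fset0Pn; exists g; rewrite inE ag bg.
- have rle a : 1 <= w a * N (s a) + \sum_(b <- W | blocked a b) w b.
    rewrite [w a in X in X + _]wE divfK ?gt_eqF// -lerBlDr le_max lexx.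
    by rewrite orbT.
  apply: (@le_trans _ _ (\sum_(a <- W) (w a * N (s a) + \sum_(b <- W | blocked a b) w b))).
    rewrite card_fset_sum1 natr_sum; exact: ler_sum.
  rewrite big_split/= mulrDl mul1r lerD2l.
  under eq_bigr do rewrite big_mkcond/=.
  rewrite exchange_big/= mulr_sumr; apply: ler_sum => b _.
  rewrite -big_mkcond/= big_const_seq iter_addr_0 -[leLHS]mulr_natr mulrCA.
  rewrite ler_wpM2l//.
  rewrite -size_filter; set f := [seq _ <- _ | _].
  have -> : size f = #|` [fset a in W | blocked a b]%fset|.
    by rewrite card_imfset//.
  apply: (temp (s b) b) => a; rewrite !inE => /andP[_ /andP[sab /fset0Pn[g]]].
  rewrite inE => /andP[/frtransP[u uP ga] /frtransP[v vP gb]].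
  by exists (s a) => //; exists u, v; split=> //; rewrite -ga.
Qed.

End Covering.

(** Summing the hypothesis on the centers with the weights of
    [covering_weights] counts each value of [psi] at most twice. *)
Lemma weak_type (R : realType) (G : semigroupType) (P : nat -> {fset G})
    (canc : cancellative G) (Pne : forall n, P n != fset0) (C : R)
    (temp : temperedness P C) (C_ge0 : 0 <= C) (M : nat) (s : G -> nat)
    (sM : forall a, (s a < M)%N) (W V : {fset G}) (psi : G -> R) (alpha : R) :
  0 <= alpha -> (forall g, 0 <= psi g) ->
  (forall a u, a \in W -> u \in P (s a) -> u ** a \in V) ->
  (forall a, a \in W ->
     alpha * #|` P (s a)|%:R <= \sum_(u <- P (s a)) psi (u ** a)) ->
  alpha * #|` W|%:R <= 2 * (1 + C) * \sum_(g <- V) psi g.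
Proof.
move=> alpha_ge0 psi_ge0 WV big.
have [w [w_ge0 w_le2 Ww]] := covering_weights canc Pne W sM temp.
have C1 : 0 <= 1 + C by rewrite addr_ge0.
apply: (le_trans (ler_wpM2l alpha_ge0 Ww)).
rewrite mulrCA [2 * _]mulrC -mulrA ler_wpM2l// mulr_sumr.
pose cell a := frtrans (P (s a)) a.
apply: (@le_trans _ _ (\sum_(a <- W) w a * \sum_(g <- V | g \in cell a) psi g)).
  rewrite big_seq [leRHS]big_seq; apply: ler_sum => a aW.
  rewrite mulrCA ler_wpM2l//; apply: (le_trans (big _ aW)).
  have -> : \sum_(u <- P (s a)) psi (u ** a) = \sum_(g <- cell a) psi g.
    by rewrite big_imfset//= => u v _ _; apply: (canc a u v).2.
  rewrite [leRHS]big_fset_condE (_ : [fset _ in V | _]%fset = cell a)//.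
  apply/fsetP => g; rewrite !inE/= andb_idl//.
  by move=> /frtransP[u uP ->]; apply: WV.
under eq_bigr do rewrite mulr_sumr big_mkcond/=.
rewrite exchange_big/= mulr_sumr; apply: ler_sum => g _.
rewrite -big_mkcond/= -mulr_suml ler_wpM2r//.
Qed.

(** * Finitely additive invariant means *)

Section Means.
Variables (R : realType) (G : semigroupType) (X : Type) (act : G -> X -> X).

Definition bdd (Y : Type) (phi : Y -> R) : Prop := exists b, forall x, `|phi x| <= b.

Definition ind (E : set X) : X -> R := fun x => (x \in E)%:R.

Definition invariant_mean (lam : (X -> R) -> R) : Prop :=
  [/\ forall (a : R) (phi psi : X -> R), bdd phi -> bdd psi ->
        lam (fun x => a * phi x + psi x) = a * lam phi + lam psi,
      forall phi : X -> R, bdd phi -> (forall x, 0 <= phi x) -> 0 <= lam phi,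
      lam (fun=> 1) = 1
    & forall (g : G) (phi : X -> R), bdd phi ->
        lam (fun x => phi (act g x)) = lam phi].

Lemma bdd_cst a : bdd (fun _ : X => a).
Proof. by exists `|a|. Qed.

Lemma bddD phi psi : bdd phi -> bdd psi -> bdd (fun x : X => phi x + psi x).
Proof.
move=> [b hb] [c hc]; exists (b + c) => x.
by rewrite (le_trans (ler_normD _ _))// lerD.
Qed.

Lemma bddM phi psi : bdd phi -> bdd psi -> bdd (fun x : X => phi x * psi x).
Proof.
move=> [b hb] [c hc]; exists (b * c) => x.
by rewrite normrM ler_pM.
Qed.

Lemma bddN phi : bdd phi -> bdd (fun x : X => - phi x).
Proof. by move=> [b hb]; exists b => x; rewrite normrN. Qed.

Lemma bddX phi n : bdd phi -> bdd (fun x : X => phi x ^+ n).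
Proof.
move=> hphi; elim: n => [|n IH]; first by exists 1 => x; rewrite expr0 normr1.
have [b hb] := bddM hphi IH; exists b => x.
by rewrite exprS; exact: hb.
Qed.

Lemma bdd_act g phi : bdd phi -> bdd (fun x => phi (act g x)).
Proof. by move=> [b hb]; exists b. Qed.

Lemma bdd_sum I (r : seq I) (p : pred I) (phi : I -> X -> R) :
  (forall i, bdd (phi i)) -> bdd (fun x => \sum_(i <- r | p i) phi i x).
Proof.
move=> hphi; elim: r => [|i r IH].
  by exists 0 => x; rewrite big_nil normr0.
have [b hb] := bddD (hphi i) IH; have [c hc] := IH.
exists (Num.max b c) => x; rewrite big_cons; case: ifP => _.
  by rewrite le_max hb.
by rewrite le_max hc orbT.
Qed.

Lemma bdd_ind E : bdd (ind E).
Proof. by exists 1 => x; rewrite /ind ger0_norm ?ler0n// lern1 leq_b1. Qed.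

Lemma bdd_unit phi : (forall x : X, 0 <= phi x <= 1) -> bdd phi.
Proof. by move=> h; exists 1 => x; have /andP[? ?] := h x; rewrite ger0_norm. Qed.

Variable lam : (X -> R) -> R.
Hypothesis lamP : invariant_mean lam.

Lemma lam1 : lam (fun=> 1) = 1. Proof. by case: lamP. Qed.

Lemma lam_ge0 phi : bdd phi -> (forall x, 0 <= phi x) -> 0 <= lam phi.
Proof. by case: lamP => _ h _ _; apply: h. Qed.

Lemma lam_act g phi : bdd phi -> lam (fun x => phi (act g x)) = lam phi.
Proof. by case: lamP => _ _ _; apply. Qed.

Lemma lamD phi psi : bdd phi -> bdd psi ->
  lam (fun x => phi x + psi x) = lam phi + lam psi.
Proof.
move=> hphi hpsi; case: lamP => lin _ _ _.
rewrite -[lam phi]mul1r -lin//; congr lam; apply/funext => x.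
by rewrite mul1r.
Qed.

Lemma lam0 : lam (fun=> 0) = 0.
Proof.
have := lamD (bdd_cst 0) (bdd_cst 0); rewrite addr0 => /eqP.
by rewrite -subr_eq subrr => /eqP.
Qed.

Lemma lamZ a phi : bdd phi -> lam (fun x => a * phi x) = a * lam phi.
Proof.
move=> hphi; case: lamP => lin _ _ _.
rewrite -[RHS]addr0 -lam0 -lin//; last exact: bdd_cst.
by congr lam; apply/funext => x; rewrite addr0.
Qed.

Lemma lam_cst a : lam (fun=> a) = a.
Proof.
rewrite -[RHS]mulr1 -lam1 -lamZ; last exact: bdd_cst.
by congr lam; apply/funext => x; rewrite mulr1.
Qed.

Lemma lamN phi : bdd phi -> lam (fun x => - phi x) = - lam phi.
Proof.
move=> hphi; rewrite -mulN1r -lamZ//; congr lam; apply/funext => x.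
by rewrite mulN1r.
Qed.

Lemma lamB phi psi : bdd phi -> bdd psi ->
  lam (fun x => phi x - psi x) = lam phi - lam psi.
Proof. by move=> hphi hpsi; rewrite lamD ?lamN//; exact: bddN. Qed.

Lemma le_lam phi psi : bdd phi -> bdd psi ->
  (forall x, phi x <= psi x) -> lam phi <= lam psi.
Proof.
move=> hphi hpsi le; rewrite -subr_ge0 -lamB//; apply: lam_ge0 => [|x].
  exact/bddD/bddN.
by rewrite subr_ge0.
Qed.

Lemma lam_sum I (r : seq I) (phi : I -> X -> R) : (forall i, bdd (phi i)) ->
  lam (fun x => \sum_(i <- r) phi i x) = \sum_(i <- r) lam (phi i).
Proof.
move=> hphi; elim: r => [|i r IH].
  by rewrite big_nil -[RHS]lam0; congr lam; apply/funext => x; rewrite big_nil.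
rewrite big_cons -IH -lamD//; last exact: bdd_sum.
by congr lam; apply/funext => x; rewrite big_cons.
Qed.

(** Finitely additive, so none of the arguments below may use a limit of
    events. *)
Definition mu (E : set X) : R := lam (ind E).

Lemma ind1 E x : E x -> ind E x = 1.
Proof. by move=> Ex; rewrite /ind mem_set. Qed.

Lemma ind0 E x : ~ E x -> ind E x = 0.
Proof. by move=> Ex; rewrite /ind memNset. Qed.

Lemma ind_ge0 E x : 0 <= ind E x. Proof. exact: ler0n. Qed.

Lemma ind_le1 E x : ind E x <= 1. Proof. by rewrite lern1 leq_b1. Qed.

Lemma mu_ge0 E : 0 <= mu E.
Proof. by apply: lam_ge0; [exact: bdd_ind|exact: ind_ge0]. Qed.

Lemma mu_le1 E : mu E <= 1.
Proof.
by rewrite -[leRHS]lam1; apply: le_lam; [exact: bdd_ind|exact: bdd_cst|exact: ind_le1].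
Qed.

Lemma le_mu A B : A `<=` B -> mu A <= mu B.
Proof.
move=> AB; apply: le_lam; try exact: bdd_ind.
move=> x; have [Ax|nAx] := pselect (A x); first by rewrite !ind1//; exact: AB.
by rewrite ind0// ind_ge0.
Qed.

Lemma muUI A B : mu (A `|` B) + mu (A `&` B) = mu A + mu B.
Proof.
rewrite /mu -!lamD; try exact: bdd_ind.
congr lam; apply/funext => x.
rewrite /ind in_setU in_setI.
by case: (x \in A); case: (x \in B); rewrite /= ?addr0 ?add0r.
Qed.

Lemma muU A B : mu (A `|` B) <= mu A + mu B.
Proof. by rewrite -muUI lerDl mu_ge0. Qed.

Lemma mu0 : mu set0 = 0.
Proof. by rewrite -[RHS]lam0; congr lam; apply/funext => x; rewrite ind0. Qed.

Lemma muT : mu setT = 1.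
Proof. by rewrite -[RHS]lam1; congr lam; apply/funext => x; rewrite ind1. Qed.

Lemma mu_bigcup (B : nat -> set X) (e : nat -> R) n :
  (forall i, (i < n)%N -> mu (B i) <= e i) ->
  mu [set x | exists2 i, (i < n)%N & B i x] <= \sum_(i < n) e i.
Proof.
elim: n => [|n IH] le_e.
  by rewrite big_ord0 -mu0; apply: le_mu => x [].
rewrite big_ord_recr/=.
apply: (@le_trans _ _ (mu ([set x | exists2 i, (i < n)%N & B i x] `|` B n))).
  apply: le_mu => x [i]; rewrite ltnS leq_eqVlt => /orP[/eqP->|lt_in] Bx.
    by right.
  by left; exists i.
apply: (le_trans (muU _ _)); apply: lerD; last exact: le_e.
by apply: IH => i lt_in; apply: le_e; exact: ltnW.
Qed.

Lemma markov phi a : 0 < a -> bdd phi -> (forall x, 0 <= phi x) ->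
  mu [set x | a < phi x] <= lam phi / a.
Proof.
move=> a0 hphi phi0; rewrite ler_pdivlMr// mulrC -lamZ; last exact: bdd_ind.
apply: le_lam => //; first by apply: bddM; [exact: bdd_cst|exact: bdd_ind].
move=> x; have [h|h] := pselect (a < phi x); first by rewrite ind1// mulr1 ltW.
by rewrite ind0// mulr0.
Qed.

Lemma mu_act g E : mu [set x | E (act g x)] = mu E.
Proof.
rewrite /mu -[RHS](lam_act g); last exact: bdd_ind.
by congr lam; apply/funext => x; congr _%:R; apply/idP/idP; rewrite !in_setE.
Qed.

Lemma mu_pick A B : mu B < mu A -> exists x, A x /\ ~ B x.
Proof.
move=> lt; apply: contrapT => no; have : mu A <= mu B.
  by apply: le_mu => x Ax; apply: contrapT => nB; apply: no; exists x.
by rewrite leNgt lt.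
Qed.

End Means.

(** * Averages over asymptotically invariant finite sets *)

Section Averages.
Variables (R : realType) (G : semigroupType).
Implicit Types (B : {fset G}) (psi : G -> R).

Definition fltrans (g : G) B : {fset G} := [fset g ** u | u in B]%fset.

Definition avg B psi : R := (\sum_(u <- B) psi u) / #|` B|%:R.

Lemma avgD B phi psi : avg B (fun u => phi u + psi u) = avg B phi + avg B psi.
Proof. by rewrite /avg big_split mulrDl. Qed.

Lemma avgZ B a psi : avg B (fun u => a * psi u) = a * avg B psi.
Proof. by rewrite /avg -mulr_sumr mulrA. Qed.

Lemma avgB B phi psi : avg B (fun u => phi u - psi u) = avg B phi - avg B psi.
Proof. by rewrite /avg sumrB mulrBl. Qed.

Lemma avg_cst B a : B != fset0 -> avg B (fun=> a) = a.
Proof.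
move=> B0; rewrite /avg big_const_seq iter_addr_0 count_predT -[_ *+ _]mulr_natr mulfK//.
by rewrite pnatr_eq0 -lt0n cardfs_gt0.
Qed.

Lemma le_avg B phi psi : (forall u, u \in B -> phi u <= psi u) -> avg B phi <= avg B psi.
Proof.
move=> le; rewrite /avg ler_wpM2r ?invr_ge0 ?ler0n//.
by rewrite big_seq [leRHS]big_seq; apply: ler_sum.
Qed.

Lemma avg_norm B psi : `|avg B psi| <= avg B (fun u => `|psi u|).
Proof.
rewrite /avg normrM normfV (ger0_norm (ler0n _ _)).
by rewrite ler_wpM2r ?invr_ge0 ?ler0n// ler_norm_sum.
Qed.

Lemma avg_ge0 B psi : (forall u, 0 <= psi u) -> 0 <= avg B psi.
Proof. by move=> h; rewrite /avg divr_ge0 ?ler0n// sumr_ge0. Qed.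

(** Jensen's inequality, from [|y| <= a / 2 + y ^+ 2 / (2 * a)]. It turns weak
    type bounds for averages into bounds by mean squares. *)
Lemma sqr_avg_gt B psi a : B != fset0 -> 0 < a ->
  a < avg B (fun u => `|psi u|) -> a ^+ 2 < avg B (fun u => psi u ^+ 2).
Proof.
move=> B0 a0 lt_a.
have : avg B (fun u => `|psi u|) <= avg B (fun u => a / 2 + (2 * a)^-1 * psi u ^+ 2).
  apply: le_avg => u _; rewrite -(real_normK (num_real (psi u))).
  rewrite -subr_ge0 (_ : _ - _ = (2 * a)^-1 * (`|psi u| - a) ^+ 2).
    by rewrite mulr_ge0 ?sqr_ge0 ?invr_ge0 ?mulr_ge0// ltW.
  by field; rewrite gt_eqF.
rewrite avgD avg_cst// avgZ => le_A.
have : a / 2 < (2 * a)^-1 * avg B (fun u => psi u ^+ 2) by lra.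
rewrite [X in _ < X]mulrC ltr_pdivlMr ?mulr_gt0//.
by rewrite (_ : a / 2 * (2 * a) = a ^+ 2)//; field.
Qed.

Lemma sum_fltrans (canc : cancellative G) B psi g b : (forall u, `|psi u| <= b) ->
  `|\sum_(u <- B) psi (g ** u) - \sum_(u <- B) psi u| <=
     2 * b * #|` (fltrans g B `\` B)%fset|%:R.
Proof.
move=> psi_b.
have ginj : {in B &, injective (fun u => g ** u)}.
  by move=> u v _ _; apply: (canc g u v).1.
have -> : \sum_(u <- B) psi (g ** u) = \sum_(v <- fltrans g B) psi v.
  by rewrite big_imfset.
have cB : #|` fltrans g B| = #|` B| by rewrite card_in_imfset.
have split_sum (S T : {fset G}) : \sum_(v <- S) psi v =
    \sum_(v <- (S `&` T)%fset) psi v + \sum_(v <- (S `\` T)%fset) psi v.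
  rewrite (big_fsetID _ (fun v => v \in T)); congr (_ + _); apply: eq_fbigl => v;
  by rewrite !inE// andbC.
rewrite (split_sum _ B) (split_sum B (fltrans g B)) fsetIC.
rewrite opprD addrACA subrr add0r.
have bound (S : {fset G}) : `|\sum_(v <- S) psi v| <= b * #|` S|%:R.
  apply: (le_trans (ler_norm_sum _ _ _)).
  rewrite card_fset_sum1 natr_sum mulr_sumr; apply: ler_sum => v _.
  by rewrite mulr1.
apply: (le_trans (ler_normB _ _)); rewrite -mulrA mulr_natl mulr2n.
apply: lerD; first exact: bound.
rewrite (_ : #|` (fltrans g B `\` B)%fset| = #|` (B `\` fltrans g B)%fset|); first exact: bound.
by rewrite !cardfsD cB fsetIC.
Qed.

Definition asym_invariant (P : nat -> {fset G}) : Prop :=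
  forall (g : G) (e : R), 0 < e -> exists N, forall n, (N <= n)%N ->
    #|` (fltrans g (P n) `\` P n)%fset|%:R <= e * #|` P n|%:R.

Lemma avg_fltrans (canc : cancellative G) (P : nat -> {fset G}) g b e :
  (forall n, P n != fset0) -> asym_invariant P -> 0 < e ->
  exists N, forall n, (N <= n)%N -> forall psi, (forall u, `|psi u| <= b) ->
    `|avg (P n) (fun u => psi (g ** u)) - avg (P n) psi| <= e.
Proof.
move=> P0 Pinv e0.
have c0 : 0 < e / (2 * (`|b| + 1)) by rewrite divr_gt0// mulr_gt0// ltr_wpDl.
have [N hN] := Pinv g _ c0; exists N => n /hN le_n psi psi_b.
have n0 : 0 < #|` P n|%:R :> R by rewrite ltr0n cardfs_gt0.
rewrite /avg -mulrBl normrM normfV (gtr0_norm n0) ler_pdivrMr//.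
have psi_b' u : `|psi u| <= `|b| + 1.
  by rewrite (le_trans (psi_b u))// (le_trans (ler_norm b))// lerDl.
apply: (le_trans (sum_fltrans canc (P n) g psi_b')).
have b0 : 0 < 2 * (`|b| + 1) by rewrite mulr_gt0// ltr_wpDl.
apply: (le_trans (ler_wpM2l (ltW b0) le_n)).
by rewrite mulrA mulrC [2 * _ * _]mulrC divfK ?gt_eqF// mulrC.
Qed.

(** The product set [K ** P n] is hardly larger than [P n]: each [u] in [K]
    adds only the few points of [u ** P n] outside [P n]. *)
Lemma small_thickening (P : nat -> {fset G}) (K : seq G) (e : R) :
  asym_invariant P -> 0 < e -> exists N, forall n, (N <= n)%N ->
    exists V : {fset G}, [/\ (P n `<=` V)%fset,
      forall u h, u \in K -> h \in P n -> u ** h \in V &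
      #|` V|%:R <= (1 + e) * #|` P n|%:R].
Proof.
move=> Pinv; elim: K e => [|u K IH] e e0.
  exists 0%N => n _; exists (P n); split=> //.
  by rewrite ler_peMl// lerDl ltW.
have e2 : 0 < e / 2 by rewrite divr_gt0.
have [N1 h1] := IH _ e2; have [N2 h2] := Pinv u _ e2.
exists (maxn N1 N2) => n; rewrite geq_max => /andP[/h1[V [PV KV cV]] /h2 cu].
exists (V `|` (fltrans u (P n) `\` P n))%fset; split.
- exact: (fsubset_trans PV (fsubsetUl _ _)).
- move=> v h; rewrite inE => /orP[/eqP->|vK] hP; rewrite in_fsetU; last by rewrite KV.
  rewrite in_fsetD in_imfset// andbT.
  by have [/(fsubsetP PV)->|] := boolP (u ** h \in P n); rewrite ?orbT.
- apply: (@le_trans _ _ (#|` V|%:R + #|` (fltrans u (P n) `\` P n)%fset|%:R)).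
    by rewrite -natrD ler_nat cardfsU leq_subr.
  by apply: (le_trans (lerD cV cu)); rewrite -mulrDl -addrA -splitr.
Qed.

End Averages.

(** * The pointwise ergodic theorem in finitary form *)

Section Maximal.
Variables (R : realType) (G : semigroupType) (X : Type) (act : G -> X -> X).
Hypothesis canc : cancellative G.
Hypothesis actM : forall g h x, act (g ** h) x = act g (act h x).
Variable lam : (X -> R) -> R.
Hypothesis lamP : invariant_mean act lam.
Variables (P : nat -> {fset G}) (C : R).
Hypothesis Pne : forall n, P n != fset0.
Hypothesis Pinv : asym_invariant R P.
Hypothesis Ptemp : temperedness P C.
Hypothesis C_ge0 : 0 <= C.

(** Transference: by invariance [mu B] is the mean of the fraction of those
    [h] in [P L] that lead [x] into [B]. Along the orbit of [x] these [h] are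
    centers for [weak_type] with [psi g = phi (act g x)], and all sums involved
    live on a set [V] containing [P n ** P L] for every [n < M]. For large [L]
    this set has at most [2 * #|P L|] elements, whence the constant
    [4 * (1 + C)]. *)
Lemma maximal_inequality (phi : X -> R) M alpha : 0 < alpha -> bdd phi ->
  (forall x, 0 <= phi x) ->
  mu lam [set x | exists2 n, (n < M)%N & alpha < avg (P n) (fun u => phi (act u x))]
    <= 4 * (1 + C) / alpha * lam phi.
Proof.
move=> a0 hphi phi0; set B := [set x | _].
pose K := flatten [seq (P n : seq G) | n <- iota 0 M].
have [L /(_ L (leqnn L))[V [PV KV cV]]] := small_thickening K Pinv ltr01.
have L0 : 0 < #|` P L|%:R :> R by rewrite ltr0n cardfs_gt0.
have pointwise x : alpha * (\sum_(h <- P L) ind R B (act h x)) <=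
    2 * (1 + C) * \sum_(g <- V) phi (act g x).
  have [M0|M0] := eqVneq M 0%N.
    rewrite big1 ?mulr0 ?mulr_ge0 ?sumr_ge0 ?addr_ge0// => h _.
    by rewrite ind0// => -[n]; rewrite M0.
  pose W := [fset h in P L | act h x \in B]%fset.
  have /choice[s sP] : forall h, exists n, (n < M)%N /\ (h \in W ->
      alpha < avg (P n) (fun u => phi (act u (act h x)))).
    move=> h; have [|_] := boolP (h \in W); last by exists 0%N; rewrite lt0n; split.
    by rewrite !inE => /andP[_ /set_mem[n nM lt_n]]; exists n.
  have -> : \sum_(h <- P L) ind R B (act h x) = #|` W|%:R.
    rewrite card_fset_sum1 natr_sum -big_fset_condE [RHS]big_mkcond/=.
    by apply: eq_bigr => h _; rewrite /ind; case: (_ \in _).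
  apply: (weak_type canc Pne Ptemp C_ge0 (fun a => (sP a).1)) => //.
  - exact: ltW.
  - move=> a u; rewrite !inE => /andP[aL _] us; apply: KV => //.
    by apply/flatten_mapP; exists (s a) => //; rewrite mem_iota (sP a).1.
  - move=> a /(sP a).2; rewrite /avg ltr_pdivlMr ?ltr0n ?cardfs_gt0// => /ltW.
    by under [in X in _ -> X]eq_bigr do rewrite actM.
have bB h : bdd (fun x => ind R B (act h x)).
  exact: bdd_act (bdd_ind _ _).
have bphi h : bdd (fun x => phi (act h x)) by exact: bdd_act hphi.
have bSB : bdd (fun x => \sum_(h <- P L) ind R B (act h x)) by exact: bdd_sum.
have bSphi : bdd (fun x => \sum_(g <- V) phi (act g x)) by exact: bdd_sum.
have le_main : alpha * (mu lam B *+ #|` P L|) <= 2 * (1 + C) * (lam phi *+ #|` V|).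
  have -> : mu lam B *+ #|` P L| = lam (fun x => \sum_(h <- P L) ind R B (act h x)).
    rewrite (lam_sum lamP)// (eq_bigr (fun=> mu lam B)).
      by rewrite big_const_seq iter_addr_0 count_predT.
    by move=> h _; exact/(lam_act lamP)/bdd_ind.
  have -> : lam phi *+ #|` V| = lam (fun x => \sum_(g <- V) phi (act g x)).
    rewrite (lam_sum lamP)// (eq_bigr (fun=> lam phi)).
      by rewrite big_const_seq iter_addr_0 count_predT.
    by move=> h _; exact: (lam_act lamP).
  rewrite -!(lamZ lamP)//; apply: (le_lam lamP) => //; apply: bddM => //; exact: bdd_cst.
have lam0 : 0 <= lam phi by exact: (lam_ge0 lamP).
have phiL0 : 0 <= (1 + C) * lam phi by rewrite mulr_ge0// addr_ge0.
have {}le_main : alpha * mu lam B * #|` P L|%:R <= 4 * ((1 + C) * lam phi) * #|` P L|%:R.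
  move: le_main; rewrite -[mu lam B *+ _]mulr_natr -[lam phi *+ _]mulr_natr !mulrA.
  move=> /le_trans; apply.
  have := ler_wpM2l phiL0 cV; lra.
rewrite mulrAC ler_pdivlMr// -mulrA [leLHS]mulrC.
by rewrite -(ler_pM2r L0).
Qed.

End Maximal.

Lemma geometric_sum (R : realType) (c : R) M :
  \sum_(j < M) (c / 2 ^+ j.+1) = c - c / 2 ^+ M.
Proof.
elim: M => [|M IH]; first by rewrite big_ord0 expr0 divr1 subrr.
rewrite big_ord_recr/= IH exprS; field.
by rewrite expf_neq0// pnatr_eq0.
Qed.

Lemma geometric_small (R : realType) (c e : R) : 0 < c -> 0 < e -> exists j, c / 2 ^+ j.+1 < e.
Proof.
move=> c0 e0; exists (Num.bound (c / e)).
have h := archi_boundP (divr_ge0 (ltW c0) (ltW e0)).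
rewrite ltr_pdivrMr ?exprn_gt0// mulrC -ltr_pdivrMr//.
apply: (lt_le_trans h); rewrite -natrX ler_nat.
by rewrite (leq_trans _ (ltnW (ltn_expl _ _)))// leqnSn.
Qed.

Section Ergodic.
Variables (R : realType) (G : semigroupType) (X : Type) (act : G -> X -> X).
Hypothesis canc : cancellative G.
Hypothesis actM : forall g h x, act (g ** h) x = act g (act h x).
Variable lam : (X -> R) -> R.
Hypothesis lamP : invariant_mean act lam.
Variables (P : nat -> {fset G}) (C : R).
Hypothesis Pne : forall n, P n != fset0.
Hypothesis Pinv : asym_invariant R P.
Hypothesis Ptemp : temperedness P C.
Hypothesis C_ge0 : 0 <= C.

Definition orbit_avg (n : nat) (phi : X -> R) (x : X) : R :=
  avg (P n) (fun u => phi (act u x)).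

Lemma bdd_avg (B : {fset G}) (phi : G -> X -> R) :
  (forall u, bdd (phi u)) -> bdd (fun x => avg B (fun u => phi u x)).
Proof.
by move=> hphi; apply: bddM; [exact: bdd_sum|exact: bdd_cst].
Qed.

Lemma lam_avg (B : {fset G}) (phi : G -> X -> R) : (forall u, bdd (phi u)) ->
  lam (fun x => avg B (fun u => phi u x)) = avg B (fun u => lam (phi u)).
Proof.
move=> hphi; rewrite /avg -(lam_sum lamP)// mulrC -(lamZ lamP); last exact: bdd_sum.
by congr lam; apply/funext => x; rewrite mulrC.
Qed.

Lemma maximal_sqr (phi : X -> R) M a : 0 < a -> bdd phi ->
  mu lam [set x | exists2 n, (n < M)%N & a < orbit_avg n (fun y => `|phi y|) x]
    <= 4 * (1 + C) / a ^+ 2 * lam (fun x => phi x ^+ 2).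
Proof.
move=> a0 hphi; apply: (le_trans _ (@maximal_inequality _ _ _ _ canc actM
  _ lamP _ _ Pne Pinv Ptemp C_ge0 (fun x => phi x ^+ 2) M _ _ _ _)) => //.
- apply: (le_mu lamP) => x [n nM lt_n]; exists n => //.
  exact: sqr_avg_gt lt_n.
- exact: exprn_gt0.
- exact: bddX.
- by move=> x; exact: sqr_ge0.
Qed.

Variable f : X -> R.
Hypothesis f01 : forall x, 0 <= f x <= 1.

(** Functions with the same limiting orbit averages as [f]. This convex set is
    invariant under the action and stands for the closed convex hull of the
    orbit of [f] in the mean ergodic theorem. *)
Definition averaged_copy (g : X -> R) : Prop :=
  [/\ forall x, 0 <= g x <= 1, lam g = lam f &
    forall e, 0 < e -> exists N, forall n, (N <= n)%N ->
      forall x, `|orbit_avg n f x - orbit_avg n g x| <= e].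

Lemma averaged_bdd g : averaged_copy g -> bdd g.
Proof. by case=> g01 _ _; exact: bdd_unit. Qed.

Lemma averaged_refl : averaged_copy f.
Proof.
split=> // e e0; exists 0%N => n _ x.
by rewrite subrr normr0 ltW.
Qed.

(** [g (act h (act u x))] is [psi (h ** u)] for [psi u = g (act u x)], so moving
    the function by [h] moves the averaging sets on the left. *)
Lemma averaged_act h g : averaged_copy g -> averaged_copy (fun x => g (act h x)).
Proof.
move=> Kg; have bg := averaged_bdd Kg; case: Kg => g01 lamg approx; split.
- by move=> x; exact: g01.
- by rewrite (lam_act lamP).
- move=> e e0; have e2 : 0 < e / 2 by rewrite divr_gt0.
  have [N1 h1] := approx _ e2.
  have [N2 h2] := @avg_fltrans _ _ canc P h 1 _ Pne Pinv e2.
  exists (maxn N1 N2) => n; rewrite geq_max => /andP[/h1 k1 /h2 k2] x.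
  have := k1 x.
  have := k2 (fun u => g (act u x)).
  rewrite /orbit_avg (_ : (fun u => g (act (h ** u) x)) = (fun u => g (act h (act u x)))).
    move=> k3 k4.
    have {}k3 : `|avg (P n) (fun u => g (act h (act u x))) -
        avg (P n) (fun u => g (act u x))| <= e / 2.
      by apply: k3 => u; have /andP[? ?] := g01 (act u x); rewrite ger0_norm.
    rewrite (le_trans (ler_distD (avg (P n) (fun u => g (act u x))) _ _))//.
    by rewrite [e]splitr lerD// distrC.
  by apply/funext => u; rewrite actM.
Qed.

Lemma averaged_mid g p : averaged_copy g -> averaged_copy p ->
  averaged_copy (fun x => 2^-1 * (g x + p x)).
Proof.
move=> Kg Kp; have bg := averaged_bdd Kg; have bp := averaged_bdd Kp.
case: Kg => g01 lamg hg; case: Kp => p01 lamp hp; split.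
- by move=> x; have := g01 x; have := p01 x; lra.
- by rewrite (lamZ lamP) ?(lamD lamP)// ?lamg ?lamp; [lra|exact: bddD].
- move=> e e0; have [N1 h1] := hg _ e0; have [N2 h2] := hp _ e0.
  exists (maxn N1 N2) => n; rewrite geq_max => /andP[/h1 k1 /h2 k2] x.
  have -> : orbit_avg n (fun x => 2^-1 * (g x + p x)) x =
      2^-1 * (orbit_avg n g x + orbit_avg n p x).
    by rewrite /orbit_avg avgZ avgD.
  have := k1 x; have := k2 x; rewrite !ler_norml; lra.
Qed.

(** An element of almost minimal norm replaces the projection of [f] on the
    invariant functions, for which a complete space would be needed. *)
Definition almost_min (k : R) (g : X -> R) : Prop :=
  averaged_copy g /\ forall p, averaged_copy p ->
    lam (fun x => g x ^+ 2) <= lam (fun x => p x ^+ 2) + k.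

Lemma almost_min_exists k : 0 < k -> exists g, almost_min k g.
Proof.
move=> k0.
pose E := [set lam (fun x => g x ^+ 2) | g in averaged_copy].
have hE : has_inf E.
  split; first by exists (lam (fun x => f x ^+ 2)), f => //; exact: averaged_refl.
  exists 0 => _ [g Kg <-]; apply: (lam_ge0 lamP) => [|x]; last exact: sqr_ge0.
  exact/bddX/averaged_bdd.
have [_ [g Kg <-] lt_g] := inf_adherent k0 hE.
exists g; split=> // p Kp; rewrite (le_trans (ltW lt_g))// lerD2r.
by apply: inf_lbound; [case: hE|exists p].
Qed.

Lemma almost_min_le k k' g : k <= k' -> almost_min k g -> almost_min k' g.
Proof.
move=> le [Kg gmin]; split=> // p /gmin /le_trans; apply.
by rewrite lerD2l.
Qed.

Lemma almost_min_act h k g : almost_min k g -> almost_min k (fun x => g (act h x)).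
Proof.
move=> [Kg gmin]; split=> [|p /gmin]; first exact: averaged_act.
rewrite (lam_act lamP h (phi := fun x => g x ^+ 2))//.
exact/bddX/averaged_bdd.
Qed.

(** The parallelogram identity: the midpoint of [g] and [p] cannot be much
    shorter than either, so they are close. *)
Lemma almost_min_close k k' g p : almost_min k g -> almost_min k' p ->
  lam (fun x => (g x - p x) ^+ 2) <= 2 * k + 2 * k'.
Proof.
move=> [Kg gmin] [Kp pmin].
have Km := averaged_mid Kg Kp.
have bg := bddX 2 (averaged_bdd Kg); have bp := bddX 2 (averaged_bdd Kp).
have bm := bddX 2 (averaged_bdd Km).
have := gmin _ Km; have := pmin _ Km; move: bm.
set m := (fun x => _ ^+ 2) => bm le1 le2.
have -> : lam (fun x => (g x - p x) ^+ 2) =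
    2 * (lam (fun x => g x ^+ 2) + lam (fun x => p x ^+ 2)) - 4 * lam m.
  rewrite -(lamD lamP)// -!(lamZ lamP)//; last exact: bddD.
  rewrite -(lamB lamP).
  - by congr lam; apply/funext => x; rewrite /m; field.
  - by apply: bddM; [exact: bdd_cst|exact: bddD].
  - by apply: bddM; [exact: bdd_cst|].
lra.
Qed.

Lemma sqr_le_markov (phi : X -> R) a : 0 < a -> bdd phi ->
  mu lam [set x | a < `|phi x|] <= lam (fun x => phi x ^+ 2) / a ^+ 2.
Proof.
move=> a0 hphi; apply: (le_trans _ (markov lamP _ _ _)).
- apply: (le_mu lamP) => x /= lt_a.
  by rewrite -(real_normK (num_real (phi x))) ltrXn2r// ltW.
- exact: exprn_gt0.
- exact: bddX.
- by move=> x; exact: sqr_ge0.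
Qed.

(** Translates of an almost minimal function are almost minimal, hence close to
    it in mean square. *)
Lemma almost_min_invariant k p n a : 0 < a -> almost_min k p ->
  mu lam [set x | a < `|orbit_avg n p x - p x|] <= 4 * k / a ^+ 2.
Proof.
move=> a0 pmin; have bp := averaged_bdd pmin.1.
have bd u : bdd (fun x => p (act u x) - p x).
  by apply: bddD; [exact: bdd_act bp|exact: bddN].
have a2 : 0 < a ^+ 2 by rewrite exprn_gt0.
apply: (@le_trans _ _ (mu lam [set x |
    a ^+ 2 < avg (P n) (fun u => (p (act u x) - p x) ^+ 2)])).
  apply: (le_mu lamP) => x /= lt_a; apply: sqr_avg_gt => //.
  apply: (lt_le_trans lt_a); apply: (le_trans _ (avg_norm _ _)).
  by rewrite avgB avg_cst.
apply: (le_trans (markov lamP a2 _ _)).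
- by apply: bdd_avg => u; exact: bddX.
- by move=> x; apply: avg_ge0 => u; exact: sqr_ge0.
- rewrite ler_wpM2r ?invr_ge0 ?(ltW a2)// lam_avg; last by move=> u; exact: bddX.
  rewrite -[leRHS](avg_cst _ (Pne n)); apply: le_avg => u _.
  by rewrite (le_trans (almost_min_close (almost_min_act u pmin) pmin))//; lra.
Qed.

(** The finitary pointwise ergodic theorem. The point is that [N] does not
    depend on [M]: the exceptional events for growing [M] increase, and their
    measure stays below [e]. Compare [g] with a far better almost minimal [p]:
    the averages of [g - p] are controlled for all [n] at once by the maximal
    inequality, and [p] may depend on [M], so that the [M] deviations of its
    averages from [p] are together negligible. *)
Lemma uniform_approximation e : 0 < e -> exists2 k, 0 < k &
  forall g, almost_min k g -> exists N, forall M,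
    mu lam [set x | exists2 n, (N <= n < M)%N & e < `|orbit_avg n f x - g x|] <= e.
Proof.
move=> e0; pose a := e / 4; have a0 : 0 < a by rewrite divr_gt0.
have a2 : 0 < a ^+ 2 by rewrite exprn_gt0.
pose D := 4 * (1 + C) + 1; have D0 : 0 < D by rewrite /D; move: C_ge0; lra.
exists (e * a ^+ 2 / (8 * D)).
  by apply: divr_gt0; apply: mulr_gt0.
set k := e * _ / _; have k0 : 0 < k by apply: divr_gt0; apply: mulr_gt0.
move=> g gmin; have bg := averaged_bdd gmin.1.
have [_ _ /(_ _ a0)[N hN]] := gmin.1; exists N => M.
have M0 : 0 < 8 * (M%:R + 1) :> R by rewrite mulr_gt0// ltr_wpDl.
pose k' := Num.min k (e * a ^+ 2 / (8 * (M%:R + 1))).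
have k'0 : 0 < k' by rewrite lt_min k0/= divr_gt0// mulr_gt0.
have [p pmin'] := almost_min_exists k'0; have bp := averaged_bdd pmin'.1.
have pmin : almost_min k p by apply: almost_min_le pmin'; rewrite ge_min lexx.
have bgp : bdd (fun x => g x - p x) by apply: bddD; [|exact: bddN].
pose B1 := [set x | exists2 n, (n < M)%N & a < orbit_avg n (fun y => `|g y - p y|) x].
pose B2 := [set x | a < `|g x - p x|].
pose B3 := [set x | exists2 n, (n < M)%N & a < `|orbit_avg n p x - p x|].
apply: (@le_trans _ _ (mu lam (B1 `|` (B2 `|` B3)))).
  apply: (le_mu lamP) => x [n /andP[/hN/(_ x) h1 nM] lt_e].
  apply: contrapT => /not_orP[n1 /not_orP[n2 n3]]; move: lt_e; apply/negP.
  have h2 : `|orbit_avg n g x - orbit_avg n p x| <= a.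
    rewrite leNgt; apply/negP => lt_a; apply: n1; exists n => //.
    by apply: (lt_le_trans lt_a); rewrite /orbit_avg -avgB; exact: avg_norm.
  have h3 : `|g x - p x| <= a by rewrite leNgt; apply/negP.
  have h4 : `|orbit_avg n p x - p x| <= a.
    by rewrite leNgt; apply/negP => lt_a; apply: n3; exists n.
  rewrite -leNgt; move: h1 h2 h3 h4; rewrite /a !ler_norml; lra.
have close : lam (fun x => (g x - p x) ^+ 2) <= 4 * k.
  by rewrite (le_trans (almost_min_close gmin pmin))//; lra.
have k_eq : D * (4 * k / a ^+ 2) = e / 2.
  by rewrite /k; field; rewrite !gt_eqF.
apply: (le_trans (muU lamP _ _)).
apply: (le_trans (lerD (lexx _) (muU lamP _ _))).
have m1 : mu lam B1 <= 4 * (1 + C) * (4 * k / a ^+ 2).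
  apply: (le_trans (maximal_sqr _ a0 bgp)).
  rewrite -mulrA ler_wpM2l ?mulr_ge0 ?addr_ge0// mulrC ler_wpM2r//.
  by rewrite invr_ge0 ltW.
have m2 : mu lam B2 <= 4 * k / a ^+ 2.
  apply: (le_trans (sqr_le_markov a0 bgp)).
  by rewrite ler_wpM2r// invr_ge0 ltW.
have m3 : mu lam B3 <= e / 2.
  apply: (@le_trans _ _ (\sum_(i < M) (4 * k' / a ^+ 2))).
    apply: (mu_bigcup lamP (B := fun n => [set x | a < `|orbit_avg n p x - p x|])
      (e := fun=> 4 * k' / a ^+ 2)) => i _; exact: almost_min_invariant.
  rewrite sumr_const card_ord -[_ *+ M]mulr_natl.
  apply: (@le_trans _ _ ((M%:R + 1) * (4 * (e * a ^+ 2 / (8 * (M%:R + 1))) / a ^+ 2))).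
    apply: ler_pM => //; first by rewrite divr_ge0 ?(ltW a2)// mulr_ge0 ?(ltW k'0).
      by rewrite lerDl.
    by rewrite ler_wpM2r ?invr_ge0 ?(ltW a2)// ler_wpM2l// ge_min lexx orbT.
  rewrite le_eqVlt; apply/orP; left; apply/eqP; field.
  by rewrite gt_eqF//= gt_eqF// ltr_wpDl.
move: k_eq m1 m2 m3; rewrite /D mulrDl mul1r.
set t := 4 * k / a ^+ 2; lra.
Qed.

Lemma lam_sqr_dev g c : averaged_copy g ->
  lam (fun x => (g x - c) ^+ 2) = lam (fun x => g x ^+ 2) - 2 * c * lam f + c ^+ 2.
Proof.
move=> Kg; have bg := averaged_bdd Kg; have [_ <- _] := Kg.
rewrite -(lamZ lamP)// -(lamB lamP).
- rewrite -[X in _ + X](lam_cst lamP) -(lamD lamP); last exact: bdd_cst.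
    by congr lam; apply/funext => x; ring.
  by apply: bddD; [exact: bddX|exact/bddN/bddM/bg/bdd_cst].
- exact: bddX.
- exact/bddM/bg/bdd_cst.
Qed.

(** Chooses precisions [e j] with thresholds [N j] in such a way that the
    total exceptional measure is smaller than that of an event [Q] on which the
    limit is at least the mean [delta] of [f]. If the norms of the averaged
    copies come arbitrarily close to [delta], the limit is constant: [g j] is
    [delta] and [Q] is everything. Otherwise the copies keep a variance of at
    least [v], so each exceeds [delta + v / 4] on an event of measure at least
    [v / 4], and the precisions can be chosen after [v]. The numbers [r j] are
    lower bounds for the values of [g j] on [Q]. *)
Lemma good_levels :
  exists (Q : set X) (g : nat -> X -> R) (e : nat -> R) (N : nat -> nat) (r : nat -> R),
    [/\ forall eps, 0 < eps -> exists j, e j < eps,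
        forall M, \sum_(j < M) e j < mu lam Q,
        forall j M, mu lam [set x | exists2 n, (N j <= n < M)%N &
                                     e j < `|orbit_avg n f x - g j x|] <= e j,
        forall j x, Q x -> r j <= g j x &
        forall d, (forall j, r j - e j <= d) -> lam f <= d].
Proof.
set delta := lam f.
have [small|large] := pselect (forall k, 0 < k -> exists2 g, averaged_copy g &
    lam (fun x => g x ^+ 2) <= delta ^+ 2 + k).
- pose e j : R := 1 / 2 ^+ j.+1.
  have e0 j : 0 < e j by rewrite divr_gt0 ?exprn_gt0.
  have /choice[N hN] : forall j, exists N, forall M,
      mu lam [set x | exists2 n, (N <= n < M)%N & e j < `|orbit_avg n f x - delta|] <= e j.
    move=> j; have ej := e0 j; move: (e j) ej => eps eps0.
    have eps2 : 0 < eps / 2 by rewrite divr_gt0.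
    have [k k0 hk] := uniform_approximation eps2.
    pose k1 := Num.min k ((eps / 2) ^+ 3).
    have k10 : 0 < k1 by rewrite lt_min k0 exprn_gt0.
    have [g Kg gk1] := small _ k10.
    have gmin : almost_min k g.
      split=> // p Kp; have : 0 <= lam (fun x => (p x - delta) ^+ 2).
        apply: (lam_ge0 lamP) => [|x]; last exact: sqr_ge0.
        by apply/bddX/bddD; [exact: averaged_bdd|exact: bdd_cst].
      rewrite lam_sqr_dev// -/delta => h.
      have : k1 <= k by rewrite ge_min lexx.
      move: gk1 h; rewrite mulrAC -mulrA -expr2; lra.
    have [N hN] := hk _ gmin; exists N => M.
    apply: (@le_trans _ _ (mu lam ([set x | exists2 n, (N <= n < M)%N &
        eps / 2 < `|orbit_avg n f x - g x|] `|` [set x | eps / 2 < `|g x - delta|]))).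
      apply: (le_mu lamP) => x [n nNM lt_e].
      apply: contrapT => /not_orP[n1 n2]; move: lt_e; apply/negP.
      have h1 : `|orbit_avg n f x - g x| <= eps / 2.
        by rewrite leNgt; apply/negP => lt_e; apply: n1; exists n.
      have h2 : `|g x - delta| <= eps / 2 by rewrite leNgt; apply/negP.
      by rewrite -leNgt; move: h1 h2; rewrite !ler_norml; lra.
    apply: (le_trans (muU lamP _ _)); rewrite [leRHS]splitr; apply: lerD => //.
    apply: (le_trans (sqr_le_markov eps2 _)).
      by apply: bddD; [exact: averaged_bdd|exact: bdd_cst].
    rewrite lam_sqr_dev// -/delta ler_pdivrMr ?exprn_gt0// -exprS.
    have : k1 <= (eps / 2) ^+ 3 by rewrite ge_min lexx orbT.
    by move: gk1; rewrite mulrAC -mulrA -expr2; lra.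
  exists setT, (fun _ _ => delta), e, N, (fun=> delta); split=> //.
  + by move=> eps eps0; apply: geometric_small.
  + move=> M; rewrite (muT lamP) geometric_sum gtrBl.
    by rewrite divr_gt0 ?exprn_gt0.
  + move=> d hd; apply/ler_addgt0Pr => eps eps0.
    have [j lt_j] := geometric_small ltr01 eps0.
    by have := hd j; rewrite /e; lra.
- have [v v0 hv] : exists2 v, 0 < v & forall g, averaged_copy g ->
      delta ^+ 2 + v < lam (fun x => g x ^+ 2).
    apply: contrapT => no; apply: large => k k0.
    apply: contrapT => no'; apply: no; exists k => // g Kg.
    by rewrite ltNge; apply/negP => le; apply: no'; exists g.
  have v4 : 0 < v / 4 by rewrite divr_gt0.
  pose e j : R := (v / 4) / 2 ^+ j.+1.
  have e0 j : 0 < e j by rewrite divr_gt0 ?exprn_gt0.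
  have /choice[g hg] : forall j, exists g, averaged_copy g /\ exists N, forall M,
      mu lam [set x | exists2 n, (N <= n < M)%N & e j < `|orbit_avg n f x - g x|] <= e j.
    move=> j; have [k k0 hk] := uniform_approximation (e0 j).
    have [g gmin] := almost_min_exists k0; exists g; split; last exact: hk.
    by case: gmin.
  have /choice[N hN] : forall j, exists N, forall M,
      mu lam [set x | exists2 n, (N <= n < M)%N & e j < `|orbit_avg n f x - g j x|] <= e j.
    by move=> j; case: (hg j).
  pose Q := [set x | delta + v / 4 < g 0%N x].
  exists Q, g, e, N, (fun j => if j is 0%N then delta + v / 4 else 0); split=> //.
  + by move=> eps eps0; apply: geometric_small.
  + move=> M; rewrite geometric_sum.
    have hgM : 0 < v / 4 / 2 ^+ M by rewrite divr_gt0 ?exprn_gt0.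
    suff : v / 4 <= mu lam Q by lra.
    have Kg := (hg 0%N).1; have bg := averaged_bdd Kg.
    have hv0 := hv _ Kg; case: (Kg) => g01 lamg _.
    (* as [g 0] and [delta] are in the unit interval, the square is at most
       [2 * (g 0 - delta)^+ - (g 0 - delta)], and the positive part is at most
       [v / 4] off [Q] *)
    have : lam (fun x => (g 0%N x - delta) ^+ 2) <=
        lam (fun x => (v / 2 + delta) + (2 * ind R Q x - g 0%N x)).
      apply: (le_lam lamP).
      - by apply/bddX/bddD; [|exact: bdd_cst].
      - apply: bddD; first exact: bdd_cst.
        by apply: bddD; [apply: bddM; [exact: bdd_cst|exact: bdd_ind]|exact: bddN].
      - move=> x /=; have /andP[gx0 gx1] := g01 x.
        have d01 : 0 <= delta <= 1.
          have bf := bdd_unit f01.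
          rewrite (lam_ge0 lamP bf) => [|y]; last by case/andP: (f01 y).
          rewrite -[leRHS](lam1 lamP); apply: (le_lam lamP) => // [|y]; first exact: bdd_cst.
          by case/andP: (f01 y).
        have [Qx|nQx] := pselect (Q x).
          rewrite ind1//; nra.
        rewrite ind0//; move/negP: nQx; rewrite -leNgt => nQx.
        have [le|lt] := lerP delta (g 0%N x); nra.
    rewrite lam_sqr_dev// (lamD lamP) ?(lamB lamP) ?(lamZ lamP) ?(lam_cst lamP)//.
    + rewrite -/(mu lam Q) lamg -/delta; move: hv0; rewrite mulrAC -mulrA -expr2; lra.
    + exact: bdd_ind.
    + by apply: bddM; [exact: bdd_cst|exact: bdd_ind].
    + exact: bdd_cst.
    + by apply: bddD; [apply: bddM; [exact: bdd_cst|exact: bdd_ind]|exact: bddN].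
  + move=> [|j] x; first by move=> /ltW.
    by case: (hg j.+1) => -[/(_ x)/andP[]].
  + move=> d /(_ 0%N); rewrite /e expr1; lra.
Qed.

End Ergodic.

(** * Sets of return times with a density *)

Lemma free_ultrafilter : exists U : set_system nat,
  UltraFilter U /\ forall N, U [set n | (N <= n)%N].
Proof.
have [U [UU sub]] := @ultraFilterLemma nat \oo _.
by exists U; split=> // N; apply: sub; exact: nbhs_infty_ge.
Qed.

Lemma ultra_cvg (R : realType) (U : set_system nat) (v : R^nat) (b : R) : UltraFilter U ->
  (forall n, `|v n| <= b) -> cvg (v @ U).
Proof.
move=> UU vb; have UP : ProperFilter U by case: UU.
have vU : (v @ U) `[- b, b]%classic.
  by apply: (@filterS _ U _ setT) filterT => n _; rewrite /= in_itv/= -ler_norml vb.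
have [p [_ pcl]] := @segment_compact R (- b) b (v @ U) _ vU.
apply/cvg_ex; exists p => B Bp.
have [//|nB] := in_ultra_setVsetC [set n | B (v n)] UU.
by have [y []] := pcl (~` B) B nB Bp.
Qed.

Section ReturnTimes.
Variables (R : realType) (G : semigroupType) (X : Type) (act : G -> X -> X).
Hypothesis canc : cancellative G.
Hypothesis Gcountable : countable [set: G].
Hypothesis actM : forall g h x, act (g ** h) x = act g (act h x).
Variable lam : (X -> R) -> R.
Hypothesis lamP : invariant_mean act lam.
Variables (P : nat -> {fset G}) (C : R).
Hypothesis Pne : forall n, P n != fset0.
Hypothesis Pinv : asym_invariant R P.
Hypothesis Ptemp : temperedness P C.
Hypothesis C_ge0 : 0 <= C.

(** The set of visits of an orbit to [E]. For each [M] there is a point [t M] of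
    [Q] outside the exceptional events of the levels below [M] and outside the
    first [M] null events [E (act s x) /\ E (act (h ** s) x)], where [h] is not
    a return time of positive measure. The required point itself need not
    exist, but the limit [S] of the sets of visits of [t M] along a free
    ultrafilter does, and it agrees on each finite set with almost all of
    them. *)
Lemma return_times (E : set X) : exists (S : set G) (d : R),
  [/\ (fun n => avg (P n) (ind R S)) @ \oo --> d,
      mu lam E <= d &
      forall h, Delta1 S h -> 0 < mu lam (E `&` [set x | E (act h x)])].
Proof.
have f01 x : 0 <= ind R E x <= 1 by rewrite ind_ge0 ind_le1.
have [Q [g [e [N [r [e_small sum_e bad_e rg lamE]]]]]] :=
  good_levels canc actM lamP Pne Pinv Ptemp C_ge0 f01.
have /countable_injP[c cinj] := Gcountable.
have {}cinj s s' : c s = c s' -> s = s' by move=> ?; apply: cinj; rewrite ?in_setE.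
pose null h := mu lam (E `&` [set x | E (act h x)]) = 0.
pose Z j := [set x | exists s h, [/\ choice.pickle (c s, c h) = j, null h,
  E (act s x) & E (act (h ** s) x)]].
have Z0 j : mu lam (Z j) = 0.
  have [[s [h [sh hnull]]]|no] := pselect (exists s h, choice.pickle (c s, c h) = j /\ null h).
    apply/eqP; rewrite eq_le (mu_ge0 lamP) andbT -[leRHS]hnull.
    rewrite -[leRHS](mu_act lamP s); apply: (le_mu lamP) => x [s' [h' [sh' _ Es Ehs]]] /=.
    have /(pcan_inj choice.pickleK)[/cinj -> /cinj ->] :
        choice.pickle (c s, c h) = choice.pickle (c s', c h').
      by rewrite sh sh'.
    by split=> //; rewrite /= -actM.
  rewrite (_ : Z j = set0) ?(mu0 lamP)//; apply/seteqP; split=> // x [s [h [sh hn _ _]]].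
  by apply: no; exists s, h.
pose B j M := [set x | exists2 n, (N j <= n < M)%N &
  e j < `|orbit_avg act P n (ind R E) x - g j x|].
(* the choice of [t] is possible since [mu Q] exceeds the sum of the [e j] *)
have /choice[t tP] : forall M, exists t, Q t /\
    forall j, (j < M)%N -> ~ B j M t /\ ~ Z j t.
  move=> M; have [t [Qt nt]] : exists t, Q t /\
      ~ [set x | exists2 j, (j < M)%N & (B j M `|` Z j) x] t.
    apply: (mu_pick lamP); apply: le_lt_trans (sum_e M).
    apply: (mu_bigcup lamP) => j _; apply: (le_trans (muU lamP _ _)).
    by rewrite Z0 addr0; exact: bad_e.
  exists t; split=> // j jM; split=> h; apply: nt; exists j => //; first by left.
  by right.
have [U [UU Ufree]] := free_ultrafilter.
have UP : ProperFilter U by case: UU.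
pose S := [set s | U [set M | E (act s (t M))]].
have S_agree (K : seq G) : U [set M | forall u, u \in K -> S u <-> E (act u (t M))].
  elim: K => [|u K IH]; first by apply: filterS filterT => M _ u.
  have Uu : U [set M | S u <-> E (act u (t M))].
    have [Su|nSu] := in_ultra_setVsetC [set M | E (act u (t M))] UU.
      by apply: filterS (Su) => M /= ?; split=> // _.
    apply: filterS (nSu) => M /= nE; split=> // Su.
    have UF : U set0.
      by apply: filterS (filterI Su nSu) => M' /= [].
    by case: (@filter_not_empty _ U _ UF).
  apply: filterS (filterI Uu IH) => M [h1 h2] v; rewrite inE => /orP[/eqP->//|].
  exact: h2.
have avg_agree n : U [set M | avg (P n) (ind R S) = orbit_avg act P n (ind R E) (t M)].
  apply: filterS (S_agree (P n)) => M h /=; rewrite /orbit_avg /avg; congr (_ / _).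
  rewrite big_seq [RHS]big_seq; apply: eq_bigr => u /h Su; rewrite /ind /=.
  by congr (nat_of_bool _)%:R; apply/idP/idP; rewrite !in_setE => /Su.
have near_g j n : (N j <= n)%N -> U [set M | Q (t M) /\
    `|avg (P n) (ind R S) - g j (t M)| <= e j].
  move=> Nn; apply: filterS (filterI (avg_agree n)
    (filterI (Ufree j.+1) (Ufree n.+1))) => M [-> [/= jM nM]].
  have [Qt /(_ _ jM)[nB _]] := tP M; split=> //.
  rewrite leNgt; apply/negP => lt_e; apply: nB; exists n => //.
  by rewrite Nn.
have cauchy_avg j n : (N j <= n)%N ->
    `|avg (P (N j)) (ind R S) - avg (P n) (ind R S)| <= 2 * e j.
  move=> Nn; have [M [[_ h1] [_ h2]]] :=
    @filter_ex _ U _ _ (filterI (near_g _ _ (leqnn (N j))) (near_g _ _ Nn)).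
  move: h1 h2; rewrite !ler_norml; lra.
have : cvg ((fun n => avg (P n) (ind R S)) @ \oo).
  apply: cauchy_cvg; apply: cauchy_exP => eps eps0.
  have eps2 : 0 < eps / 2 by rewrite divr_gt0.
  have [j ej] := e_small _ eps2.
  exists (avg (P (N j)) (ind R S)); exists (N j) => // n /= Nn.
  rewrite /ball/=; apply: (le_lt_trans (cauchy_avg _ _ Nn)); lra.
move=> cvg_avg; exists S, (lim ((fun n => avg (P n) (ind R S)) @ \oo)); split=> //.
- apply: lamE => j; apply: limr_ge => //; exists (N j) => // n /= Nn.
  have [M [Qt h]] := @filter_ex _ U _ _ (near_g _ _ Nn).
  have := rg j _ Qt; move: h; rewrite ler_norml; lra.
- move=> h [s [Ss Shs]]; rewrite lt_neqAle (mu_ge0 lamP) andbT.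
  apply/eqP => /esym hnull.
  have [M [/= Es [/= Ehs jM]]] := @filter_ex _ U _ _
    (filterI Ss (filterI Shs (Ufree (choice.pickle (c s, c h)).+1))).
  have [_ /(_ _ jM)[_]] := tP M; apply.
  by exists s, h; split.
Qed.

End ReturnTimes.

(** * Upper density and finite averages *)

Section UpperDensity.
Variables (R : realType) (u : R^nat).
Hypothesis u01 : forall n, 0 <= u n <= 1.

Let u_ub : has_ubound (range u).
Proof. by exists 1 => _ [n _ <-]; case/andP: (u01 n). Qed.

Let u_lb : has_lbound (range u).
Proof. by exists 0 => _ [n _ <-]; case/andP: (u01 n). Qed.

Let sups_cvg : sups u @ \oo --> limn_sup u.
Proof.
have h := cvg_sups_inf u_ub u_lb.
by rewrite /limn_sup (cvg_lim _ h).
Qed.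

Let le_sups n m : (n <= m)%N -> u m <= sups u n.
Proof.
move=> nm; apply: ub_le_sup; last by exists m.
by exists 1 => _ [p _ <-]; case/andP: (u01 p).
Qed.

Lemma limn_sup_frequently eps N : 0 < eps ->
  exists2 n, (N <= n)%N & limn_sup u - eps < u n.
Proof.
move=> eps0; have le : limn_sup u <= sups u N.
  rewrite /limn_sup (cvg_lim _ (cvg_sups_inf u_ub u_lb))//.
  apply: inf_lbound; last by exists N.
  by exists 0 => _ [n _ <-]; apply: le_trans (le_sups (leqnn n)); case/andP: (u01 n).
have hs : has_sup (sdrop u N).
  split; first by exists (u N); exists N => /=.
  by exists 1 => _ [n _ <-]; case/andP: (u01 n).
have [_ [n /= Nn <-] lt_n] := sup_adherent eps0 hs.
exists n => //; apply: le_lt_trans lt_n.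
by rewrite lerD2r.
Qed.

(** For frequencies, the vanishing of the upper density is convergence to 0,
    which passes to subsequences and is stable under translation. *)
Lemma limn_sup_gt0 : 0 < limn_sup u <-> ~ (u @ \oo --> (0 : R)).
Proof.
split=> [lt0 u0|nu]; first by move: lt0; rewrite (cvg_limn_inf_sup u0).2 ltxx.
rewrite ltNge; apply/negP => le0; apply: nu.
apply/cvgrPdist_le => eps eps0.
have /cvgrPdist_lt/(_ _ eps0)[N _ hN] := sups_cvg.
exists N => // n /= Nn; have /andP[un0 _] := u01 n.
rewrite sub0r normrN ger0_norm//; have := hN N (leqnn N).
rewrite /= ltr_distlC => /andP[_ h2]; have := le_sups Nn; lra.
Qed.

End UpperDensity.

Section FolnerSets.
Variables (R : realType) (G : semigroupType) (F : nat -> set G).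
Hypothesis Ffolner : folner R F.

Definition fsets (n : nat) : {fset G} := fset_set (F n).

Lemma in_fsets n g : g \in fsets n <-> F n g.
Proof. by rewrite /fsets in_fset_set ?in_setE//; case: (Ffolner.1 n). Qed.

Lemma fsets_neq0 n : fsets n != fset0.
Proof.
by have [_ [g Fg]] := Ffolner.1 n; apply/fset0Pn; exists g; apply/in_fsets.
Qed.

Lemma rel_freqE S n : rel_freq R F S n = avg (fsets n) (ind R S).
Proof.
rewrite /rel_freq /avg /Defs.card; congr (_ / _).
have -> : fset_set (S `&` F n) = [fset g in fsets n | g \in S]%fset; last first.
  rewrite card_fset_sum1 natr_sum -big_fset_condE big_mkcond/=.
  by apply: eq_bigr => g _; rewrite /ind; case: (g \in S).
have fin : finite_set (S `&` F n) by apply: finite_setIr; case: (Ffolner.1 n).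
apply/fsetP => g; rewrite !inE in_fset_set// in_setI andbC; congr (_ && _).
by apply/idP/idP => [/set_mem/in_fsets//|/in_fsets/mem_set].
Qed.

Lemma rel_freq01 S n : 0 <= rel_freq R F S n <= 1.
Proof.
rewrite rel_freqE avg_ge0 => [|g]; last exact: ind_ge0.
rewrite -[leRHS](avg_cst 1 (fsets_neq0 n)); apply: le_avg => g _; exact: ind_le1.
Qed.

Lemma folner_asym_invariant : cancellative G -> asym_invariant R fsets.
Proof.
move=> canc g e e0; have /cvgrPdist_le/(_ _ e0)[N _ hN] := Ffolner.2 g.
exists N => n /= Nn; have := hN n Nn => /=.
have n0 : 0 < #|` fsets n|%:R :> R by rewrite ltr0n cardfs_gt0 fsets_neq0.
rewrite /Defs.card.
have -> : fset_set (F n `&` ltrans g (F n)) = (fsets n `&` fltrans g (fsets n))%fset; last first.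
  rewrite fsetIC ler_norml => /andP[_]; rewrite lerBlDr -lerBlDl ler_pdivlMr// => h.
  have cg : #|` fltrans g (fsets n)| = #|` fsets n|.
    by rewrite card_imfset// => u v; apply: (canc g u v).1.
  have : #|` fltrans g (fsets n)|%:R = #|` (fltrans g (fsets n) `&` fsets n)%fset|%:R +
      #|` (fltrans g (fsets n) `\` fsets n)%fset|%:R :> R.
    by rewrite -natrD cardfsID.
  rewrite cg; lra.
have fin : finite_set (F n `&` ltrans g (F n)).
  by apply: finite_setIl; case: (Ffolner.1 n).
apply/fsetP => x; rewrite in_fset_set// in_fsetI; apply/idP/andP.
  move=> /set_mem[Fx [a Fa ax]]; split; first by apply/in_fsets.
  by rewrite -ax; apply: in_imfset; apply/in_fsets.
move=> [/in_fsets Fx /imfsetP[a /= /in_fsets Fa xE]]; apply/mem_set; split=> //.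
by exists a.
Qed.

Lemma folner_tempered : tempered R F ->
  exists2 C : R, 0 <= C & temperedness fsets C.
Proof.
move=> [C [C0 temp]]; exists C; first exact: ltW.
move=> [|n] g A sub.
  have -> : A = fset0.
    by apply/eqP; apply/negPn/negP => /fset0Pn[a /sub[]].
  by rewrite cardfs0 mulr_ge0 ?(ltW C0).
have [fin le] := temp n.+1 g isT.
apply: le_trans le; rewrite ler_nat /Defs.card; apply: fsubset_leq_card.
apply/fsubsetP => a /sub[i lt_in [u [v [/in_fsets Fu /in_fsets Fv uv]]]].
rewrite in_fset_set//; apply/mem_set; exists i => //; exists u => //.
by rewrite /linv /rtrans /= uv; exists v.
Qed.

End FolnerSets.

(** * Invariant means attached to Folner sequences *)

Section FolnerMean.
Variables (R : realType) (G : semigroupType) (F : nat -> set G).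
Hypothesis canc : cancellative G.
Hypothesis Ffolner : folner R F.

Let P := fsets F.

(** The limit of averages along a free ultrafilter, over a subsequence that
    realizes the upper density of [A]. *)
Lemma folner_mean (A : set G) : exists lam : (G -> R) -> R,
  [/\ invariant_mean (fun g x => g ** x) lam,
      upper_density R F A <= mu lam A &
      forall B, rel_freq R F B @ \oo --> (0 : R) -> mu lam B = 0].
Proof.
have /choice[n nP] : forall j, exists n, (j <= n)%N /\
    upper_density R F A - j.+1%:R^-1 < rel_freq R F A n.
  move=> j; have j0 : 0 < j.+1%:R^-1 :> R by rewrite invr_gt0.
  by have [n] := limn_sup_frequently (rel_freq01 Ffolner A) j j0; exists n.
have [U [UU Ufree]] := free_ultrafilter.
have UP : ProperFilter U by case: UU.
pose a (phi : G -> R) j := avg (P (n j)) phi.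
have a_cvg phi : bdd phi -> cvg (a phi @ U).
  move=> [b hb]; apply: (@ultra_cvg _ U _ b UU) => j.
  apply: (le_trans (avg_norm _ _)); rewrite -[leRHS](avg_cst _ (fsets_neq0 Ffolner (n j))).
  exact: le_avg.
have limE (v : R^nat) l : v @ U --> l -> lim (v @ U) = l by apply: cvg_lim.
exists (fun phi => lim (a phi @ U)); split; first split.
- move=> c phi psi /a_cvg hphi /a_cvg hpsi; apply: limE.
  rewrite (_ : a _ = fun j => c * a phi j + a psi j).
    by apply: cvgD => //; exact: cvgMr.
  by apply/funext => j; rewrite /a avgD avgZ.
- move=> phi /a_cvg hphi phi0; apply: limr_ge => //.
  by apply: filterS filterT => j _; exact: avg_ge0.
- apply: limE; rewrite (_ : a _ = fun=> 1); first exact: cvg_cst.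
  by apply/funext => j; rewrite /a avg_cst//; exact: (fsets_neq0 Ffolner).
- move=> g phi bphi; have hphi := a_cvg _ bphi; case: bphi => b hb.
  apply: limE; rewrite (_ : a _ = fun j => a phi j + (a (fun x => phi (g ** x)) j - a phi j)); last first.
    by apply/funext => j; rewrite addrC subrK.
  rewrite -[X in _ --> X]addr0; apply: cvgD => //.
  apply/cvgrPdist_le => eps eps0.
  have [N hN] := @avg_fltrans _ _ canc P g b _ (fsets_neq0 Ffolner)
    (folner_asym_invariant Ffolner canc) eps0.
  apply: filterS (Ufree N) => j /= Nj; rewrite sub0r normrN.
  by apply: hN => //; exact: leq_trans Nj (nP j).1.
- apply/ler_addgt0Pr => eps eps0; rewrite -lerBlDr; apply: limr_ge.
    by apply: a_cvg; exact: bdd_ind.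
  apply: filterS (Ufree (Num.bound eps^-1)) => j /= hj.
  rewrite /a -rel_freqE//; apply: le_trans (ltW (nP j).2).
  rewrite lerD2l lerN2 -[leRHS]invrK lef_pV2 ?posrE ?invr_gt0//.
  have eps0' : 0 <= eps^-1 by rewrite invr_ge0 ltW.
  apply: (le_trans (ltW (archi_boundP eps0'))).
  by rewrite ler_nat (leq_trans hj).
- move=> B /cvgrPdist_le B0; apply: limE; apply/cvgrPdist_le => eps eps0.
  have [N _ hN] := B0 _ eps0; apply: filterS (Ufree N) => j /= Nj.
  rewrite /a -rel_freqE//; apply: hN => /=; exact: leq_trans Nj (nP j).1.
Qed.

End FolnerMean.

(** * Products of systems *)

Section Product.
Variables (R : realType) (G : semigroupType).

Lemma norm_lam (X : Type) (act : G -> X -> X) (lam : (X -> R) -> R) (phi : X -> R) b :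
  invariant_mean act lam -> (forall x, `|phi x| <= b) -> `|lam phi| <= b.
Proof.
move=> lamP hb; have bphi : bdd phi by exists b.
rewrite ler_norml -[X in - X <= _](lam_cst lamP) -(lamN lamP); last exact: bdd_cst.
rewrite -[X in _ && (_ <= X)](lam_cst lamP).
apply/andP; split; apply: (le_lam lamP) => //; try exact: bdd_cst;
  by move=> x; have := hb x; rewrite ler_norml => /andP[].
Qed.

(** Iterating two means. The second factor may be moved at each fixed [x] and the
    first one afterwards, so invariance under the diagonal action needs no
    exchange of the two means. *)
Lemma product_mean (X Y : Type) (actX : G -> X -> X) (actY : G -> Y -> Y)
    (lamX : (X -> R) -> R) (lamY : (Y -> R) -> R) :
  invariant_mean actX lamX -> invariant_mean actY lamY ->
  invariant_mean (fun g (z : X * Y) => (actX g z.1, actY g z.2))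
    (fun phi => lamX (fun x => lamY (fun y => phi (x, y)))).
Proof.
move=> lamXP lamYP.
have bY phi x : bdd phi -> bdd (fun y => phi ((x, y) : X * Y)).
  by move=> [b hb]; exists b.
have bX phi : bdd phi -> bdd (fun x => lamY (fun y => phi ((x, y) : X * Y))).
  by move=> [b hb]; exists b => x; apply: (norm_lam lamYP).
split.
- move=> a phi psi hphi hpsi /=; rewrite -(lamZ lamXP); last exact: bX.
  rewrite -(lamD lamXP); [|exact/bddM/bX/hphi/bdd_cst|exact: bX].
  congr lamX; apply/funext => x.
  rewrite (lamD lamYP); [|exact/bddM/bY/hphi/bdd_cst|exact: bY].
  by rewrite (lamZ lamYP a (phi := fun y => phi (x, y)))//; exact: bY.
- move=> phi hphi phi0; apply: (lam_ge0 lamXP) => [|x]; first exact: bX.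
  by apply: (lam_ge0 lamYP) => //; exact: bY.
- rewrite -[RHS](lam1 lamXP); congr lamX; apply/funext => x; exact: (lam1 lamYP).
- move=> g phi hphi /=; rewrite -[RHS](lam_act lamXP g); last exact: bX.
  congr lamX; apply/funext => x.
  by rewrite (lam_act lamYP g (phi := fun y => phi (actX g x, y)))//; exact: bY.
Qed.

Lemma mu_prod (X Y : Type) (actX : G -> X -> X) (actY : G -> Y -> Y)
    (lamX : (X -> R) -> R) (lamY : (Y -> R) -> R) (A : set X) (B : set Y) :
  invariant_mean actX lamX -> invariant_mean actY lamY ->
  mu (fun phi => lamX (fun x => lamY (fun y => phi (x, y)))) (A `*` B) =
    mu lamX A * mu lamY B.
Proof.
move=> lamXP lamYP; rewrite /mu mulrC -(lamZ lamXP); last exact: bdd_ind.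
congr lamX; apply/funext => x; rewrite mulrC -(lamZ lamYP); last exact: bdd_ind.
congr lamY; apply/funext => y; rewrite /ind -natrM mulnb; congr (nat_of_bool _)%:R.
by rewrite in_setX.
Qed.

Lemma diagonal_system (k : nat) (lams : 'I_k -> (G -> R) -> R) (A : 'I_k -> set G) :
  (forall i, invariant_mean (fun g x => g ** x) (lams i)) ->
  exists (X : Type) (act : G -> X -> X) (lam : (X -> R) -> R) (E : set X),
  [/\ forall g h x, act (g ** h) x = act g (act h x),
      invariant_mean act lam,
      mu lam E = \prod_(i < k) mu (lams i) (A i) &
      forall h, mu lam (E `&` [set x | E (act h x)]) =
        \prod_(i < k) mu (lams i) (A i `&` linv h (A i))].
Proof.
elim: k lams A => [|k IH] lams A lamsP.
  exists unit, (fun _ x => x), (fun phi => phi tt), setT; split=> //.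
  - by rewrite big_ord0 /mu ind1.
  - by move=> h; rewrite big_ord0 /mu ind1.
have [X [act [lam [E [actM lamP muE muEh]]]]] :=
  IH (fun i => lams (widen_ord (leqnSn k) i)) (fun i => A (widen_ord (leqnSn k) i))
    (fun i => lamsP _).
exists (X * G)%type, (fun g z => (act g z.1, g ** z.2)),
  (fun phi => lam (fun x => lams ord_max (fun y => phi (x, y)))), (E `*` A ord_max).
split.
- by move=> g h [x y] /=; rewrite actM mulgA.
- exact: (product_mean lamP (lamsP ord_max)).
- by rewrite (mu_prod _ _ lamP (lamsP _)) muE big_ord_recr.
- move=> h; rewrite big_ord_recr/= -muEh -(mu_prod _ _ lamP (lamsP _)).
  congr mu; apply/seteqP; split=> -[x y] /=; rewrite /linv /=; by move=> [[? ?] [? ?]].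
Qed.

End Product.

(** * Covering by translates of the return set *)

Section Syndeticity.
Variables (R : realType) (G : semigroupType) (X : Type) (act : G -> X -> X).
Hypothesis actM : forall g h x, act (g ** h) x = act g (act h x).
Variable lam : (X -> R) -> R.
Hypothesis lamP : invariant_mean act lam.
Variable E : set X.
Hypothesis muE : 0 < mu lam E.

Let returns g := 0 < mu lam (E `&` [set x | E (act g x)]).

(** A greedy construction of pairwise null-disjoint preimages of [E] under
    elements [ys], which cannot exceed the total mass 1. As long as the
    elements [ms] fail at some [g], put [y = g ** z], where [z] is a common
    left multiple [m ** y'] of the elements [y'] so far with [m] in [ms]. Then
    [y = (g ** m) ** y'] is separated from [y'] by an element which is not a
    return. Since left multiples need not exist in advance, [ms] and [z] are
    renewed at each step: multiplication by [c ** g] maintains the link with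
    the old elements, and [c] provides it for [y]. *)
Lemma syndetic_returns (c : G) : exists ms : seq G,
  (size ms)%:R * mu lam E <= 1 /\ forall g, exists2 m, m \in ms & returns (g ** m).
Proof.
apply: contrapT => no.
suff H j : exists (ms ys : seq G) (z : G), [/\ size ms = j,
    forall y, y \in ys -> exists2 m, m \in ms & m ** y = z &
    j%:R * mu lam E <= mu lam [set x | exists2 y, y \in ys & E (act y x)]].
  have [ms [ys [z [_ _ le]]]] := H (Num.bound (mu lam E)^-1).
  have := le_trans le (mu_le1 lamP _); apply/negP; rewrite -ltNge.
  rewrite -ltr_pdivrMr// div1r; apply: archi_boundP.
  by rewrite invr_ge0 ltW.
elim: j => [|j [ms [ys [z [sz link le]]]]].
  by exists [::], [::], c; split=> //; rewrite mul0r (mu_ge0 lamP).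
have [g hg] : exists g, forall m, m \in ms -> ~ returns (g ** m).
  apply: contrapT => no'; apply: no; exists ms; split.
    by rewrite sz (le_trans le (mu_le1 lamP _)).
  move=> g; apply: contrapT => ng; apply: no'; exists g => m mms ret.
  by apply: ng; exists m.
exists (c :: map (fun m => c ** g ** m) ms), (g ** z :: ys), (c ** (g ** z)); split.
- by rewrite /= size_map sz.
- move=> y; rewrite inE => /orP[/eqP->|/link[m mms myz]].
    by exists c; rewrite ?mem_head.
  exists (c ** g ** m); first by rewrite inE map_f ?orbT.
  by rewrite -!mulgA myz.
- set V := [set x | _] in le; set Y := [set x | E (act (g ** z) x)].
  have null : mu lam (Y `&` V) = 0.
    have sub : forall s : seq G, {subset s <= ys} ->
        mu lam (Y `&` [set x | exists2 y, y \in s & E (act y x)]) = 0.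
      elim=> [|y s IH] sys.
        rewrite (_ : _ `&` _ = set0) ?(mu0 lamP)//.
        by apply/seteqP; split=> // x [_ []].
      apply/eqP; rewrite eq_le (mu_ge0 lamP) andbT.
      have yys : y \in ys by apply: sys; rewrite mem_head.
      have [m mms myz] := link _ yys.
      apply: (@le_trans _ _ (mu lam (
          [set x | (E `&` [set x | E (act (g ** m) x)]) (act y x)] `|`
          (Y `&` [set x | exists2 y, y \in s & E (act y x)])))).
        apply: (le_mu lamP) => x [Yx [y']]; rewrite inE => /orP[/eqP->|y's] Ex.
          by left; split=> //=; rewrite -actM -mulgA myz.
        by right; split=> //; exists y'.
      apply: (le_trans (muU lamP _ _)); rewrite (mu_act lamP) IH ?addr0.
        by rewrite leNgt; apply/negP; exact: hg.
      by move=> w ws; apply: sys; rewrite inE ws orbT.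
    exact: sub.
  apply: (@le_trans _ _ (mu lam (Y `|` V))).
    rewrite -[leRHS]addr0 -null (muUI lamP) (mu_act lamP) -natr1 mulrDl mul1r addrC.
    by rewrite lerD2l.
  apply: (le_mu lamP) => x [Yx|[y yys Ex]].
    by exists (g ** z); rewrite ?mem_head.
  by exists y; rewrite ?inE ?yys ?orbT.
Qed.

End Syndeticity.

(** In a group, [A] meets its translates by [h] and by its inverse in sets that
    are translates of one another, and translation preserves upper density. *)
Lemma Delta2_inv (R : realType) (G : semigroupType) (F : nat -> set G) (A : set G)
    (canc : cancellative G) (Ffolner : folner R F) (h h' e : G) :
  (forall x, e ** x = x) -> h' ** h = e ->
  Delta2 R F A h -> Delta2 R F A h'.
Proof.
move=> ex hh'; rewrite /Delta2 /= /upper_density.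
rewrite !limn_sup_gt0; try exact: (rel_freq01 Ffolner).
apply: contra_not => /cvgrPdist_le h0; apply/cvgrPdist_le => eps eps0.
have eps2 : 0 < eps / 2 by rewrite divr_gt0.
have [N1 _ hN1] := h0 _ eps2.
have [N2 hN2] := @avg_fltrans _ _ canc _ h 1 _ (fsets_neq0 Ffolner)
  (folner_asym_invariant Ffolner canc) eps2.
exists (maxn N1 N2) => // n /=; rewrite geq_max => /andP[/hN1 k1 /hN2 k2].
have {k2} : `|avg (fsets F n) (ind R (A `&` linv h A)) -
    avg (fsets F n) (ind R (A `&` linv h' A))| <= eps / 2.
  rewrite (_ : ind R (A `&` linv h A) = fun u => ind R (A `&` linv h' A) (h ** u)).
    by apply: k2 => u; rewrite ger0_norm ?ind_ge0// ind_le1.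
  apply/funext => u; rewrite /ind; congr (nat_of_bool _)%:R.
  by apply/idP/idP; rewrite !in_setE /linv/= mulgA hh' ex => -[].
move: k1 => /=; rewrite !(rel_freqE Ffolner) !ler_norml; lra.
Qed.

Theorem theorem4p24 (R : realType) (G : semigroupType)
    (Gcountable : countable [set: G]) (Ginfinite : infinite_set [set: G])
    (Gamenable : left_amenable R G) (Gcancel : cancellative G)
    (k : nat) (k_gt0 : (0 < k)%N)
    (GG : nat -> set G) (F : 'I_k -> nat -> set G)
    (GGfolner : folner R GG) (Ffolner : forall i : 'I_k, folner R (F i))
    (GGtempered : tempered R GG)
    (A : 'I_k -> set G)
    (Apos : forall i : 'I_k, 0 < upper_density R (F i) (A i)) :
  let D : set G := \bigcap_(i in [set: 'I_k]) Delta2 R (F i) (A i) in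
  (exists (S : set G) (d : R),
     [/\ has_density GG S d,
         \prod_(i < k) upper_density R (F i) (A i) <= d
       & Delta1 S `<=` D]) /\
  (exists (l : nat) (m : 'I_l -> G),
     [/\ (l%:R : R) <= \prod_(i < k) (1 / upper_density R (F i) (A i)),
         \bigcup_(i in [set: 'I_l]) rinv D (m i) = [set: G]
       & is_group G ->
           \bigcup_(i in [set: 'I_l]) ltrans (m i) D = [set: G]]).
Proof.
move=> D.
have /choice[lams lamsP] := fun i => folner_mean Gcancel (Ffolner i) (A i).
have [X [act [lam [E [actM lamP muE muEh]]]]] :=
  diagonal_system A (fun i => let: And3 h _ _ := lamsP i in h).
have le_muE : \prod_(i < k) upper_density R (F i) (A i) <= mu lam E.
  by rewrite muE; apply: ler_prod => i _; rewrite ltW//=; case: (lamsP i).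
have prod0 : 0 < \prod_(i < k) upper_density R (F i) (A i) by apply: prodr_gt0.
have muE0 : 0 < mu lam E by exact: lt_le_trans le_muE.
have returnsD h : 0 < mu lam (E `&` [set x | E (act h x)]) -> D h.
  rewrite muEh => ret i _; rewrite /Delta2 /= /upper_density.
  apply/limn_sup_gt0; first exact: (rel_freq01 (Ffolner i)).
  move=> freq0; have [_ _ /(_ _ freq0) null] := lamsP i.
  by move: ret; rewrite (bigD1 i)//= null mul0r ltxx.
split.
- have [C C0 temp] := folner_tempered GGfolner GGtempered.
  have [S [d [Sd le_d SE]]] := return_times Gcancel Gcountable actM lamP
    (fsets_neq0 GGfolner) (folner_asym_invariant GGfolner Gcancel) temp C0 E.
  exists S, d; split.
  + rewrite /has_density (_ : rel_freq R GG S = fun n => avg (fsets GG n) (ind R S))//.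
    by apply/funext => n; exact: rel_freqE.
  + exact: le_trans le_d.
  + by move=> h /SE; exact: returnsD.
- have [_ [c _]] := GGfolner.1 0%N.
  have [ms [size_ms cover]] := syndetic_returns actM lamP muE0 c.
  have coverD : \bigcup_(i in [set: 'I_(size ms)]) rinv D (nth c ms i) = [set: G].
    apply/seteqP; split=> // g _; have [m mms /returnsD Dgm] := cover g.
    have lt_m : (index m ms < size ms)%N by rewrite index_mem.
    by exists (Ordinal lt_m) => //; rewrite /rinv /= nth_index.
  exists (size ms), (fun i => nth c ms i); split=> //.
  + rewrite (eq_bigr (fun i => (upper_density R (F i) (A i))^-1)); last first.
      by move=> i _; rewrite div1r.
    rewrite prodfV -div1r ler_pdivlMr//; apply: le_trans size_ms.
    by rewrite ler_wpM2l.
  + move=> [e [inv group]]; apply/seteqP; split=> // g _.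
    have : (\bigcup_(i in [set: 'I_(size ms)]) rinv D (nth c ms i)) (inv g).
      by rewrite coverD.
    move=> [i _ Di]; exists i => //; set m := nth c ms i in Di *.
    have inve x : e ** x = x by case: (group x).
    have xe x : x ** e = x by case: (group x).
    have invl x : inv x ** x = e by case: (group x).
    have invr x : x ** inv x = e by case: (group x).
    exists (inv m ** g); last by rewrite mulgA invr inve.
    move=> j _; apply: (Delta2_inv Gcancel (Ffolner j) (h := inv g ** m) (e := e)) => //.
    * by rewrite mulgA -[inv m ** g ** _]mulgA invr xe invl.
    * exact: Di.
Qed.
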